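(* Let $r,s$ be nonzero complex numbers such that $rs^{-1}$ is not a root of unity, and let $m\ge 1$. Let $\lambda=(\lambda_1,\dots,\lambda_l)$ be a partition of $m$ with conjugate partition $\lambda'=(\lambda'_1,\dots,\lambda'_{l'})$, and let $T$ be a standard $\lambda$-tableau with $(r,s)$-contents $\sigma_1,\dots,\sigma_m$. Then $$E^{\lambda}_T=f(\lambda)\,\Psi(u_1,\dots,u_m)\big|_{u_1=\sigma_1}\big|_{u_2=\sigma_2}\cdots\big|_{u_m=\sigma_m},$$ where the evaluations are carried out consecutively (first $u_1=\sigma_1$, then $u_2=\sigma_2$, etc.), and $$f(\lambda)=\Big(\frac{s}{r}\Big)^{b(\lambda')}\,s^{-\binom{m}{2}}\Big(1-\frac{s}{r}\Big)^m\prod_{\alpha\in\lambda}\Big(1-\Big(\frac{s}{r}\Big)^{h_\alpha}\Big)^{-1},$$ with $b(\lambda')=\sum_{i\ge1}\binom{\lambda_i}{2}$ and, for a cell $\alpha=(i,j)$ of $\lambda$, $h_\alpha=\lambda_i+\lambda'_j-i-j+1$ its hook length.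
   Context: The Hecke algebra $H_m(r,s)$ is the unital associative $\mathbb{C}$-algebra with generators $T_1,\dots,T_{m-1}$ and relations $T_iT_{i+1}T_i=T_{i+1}T_iT_{i+1}$, $T_iT_j=T_jT_i$ for $|i-j|>1$, and $(T_i-1)(T_i+\frac{r}{s})=0$. For $x,y$ complex variables put $T_i(x,y)=sT_i+\frac{s-r}{y/x-1}$, a rational function with values in $H_m(r,s)$. Let $T_{w_1}=1$ and $T_{w_k}=(T_1T_2\cdots T_{k-1})(T_1\cdots T_{k-2})\cdots(T_1T_2)T_1$, the element corresponding to the longest element of $\mathfrak S_k$. Define $$\Psi(u_1,\dots,u_m)=\prod_{k=1}^{m-1}\big(T_k(u_1,u_{k+1})T_{k-1}(u_2,u_{k+1})\cdots T_1(u_k,u_{k+1})\big)\cdot T_{w_m}^{-1},$$ the product taken in increasing order of $k$ from left to right. Young diagrams are left-justified with row $i$ having $\lambda_i$ cells; a cell in position $(i,j)$ (row $i$, column $j$) has $(r,s)$-content $(s/r)^{j-i}$. A standard $\lambda$-tableau is a filling of the diagram bijectively by $1,\dots,m$ increasing along rows and down columns; $\sigma_k$ is the $(r,s)$-content of the cell containing $k$. A cell outside a diagram $\mu$ is addable if adding it gives a Young diagram. Jucys–Murphy elements: $y_1=1$, $y_{k+1}=\frac{s}{r}T_ky_kT_k$. The idempotents $E^\lambda_T$ are defined inductively: $E^\lambda_T=1$ if $m=1$; for $m\ge2$, $E^\lambda_T=E^\mu_U\frac{(y_m-\rho_1)\cdots(y_m-\rho_k)}{(\sigma-\rho_1)\cdots(\sigma-\rho_k)}$,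 where $U$ is obtained from $T$ by removing the cell $\alpha$ containing $m$, $\mu$ is the shape of $U$, $\rho_1,\dots,\rho_k$ are the $(r,s)$-contents of the addable cells of $\mu$ other than $\alpha$, and $\sigma$ is the $(r,s)$-content of $\alpha$. *)

(* Defs.v *)
From HB Require Import structures.
From mathcomp Require Import all_boot all_order all_algebra.
From mathcomp Require Import complex Rstruct.
From mathcomp Require Import fraction.
From mathcomp Require Import boolp.

Set Implicit Arguments.
Unset Strict Implicit.
Unset Printing Implicit Defensive.

Import GRing.Theory.
Local Open Scope ring_scope.

Definition CC : numClosedFieldType := (Rdefinitions.R)[i].

(* Iterated rational function fields.
   RF 0 = C,  RF (n+1) = RF n (x)  (field of fractions of {poly RF n}).
   In RF m the variables are u_1, ..., u_m where u_1 is the OUTERMOST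
   variable: RF m = C(u_m)(u_{m-1})...(u_1).  This nesting is exactly
   what is needed for the consecutive evaluation u_1 = sigma_1, then
   u_2 = sigma_2, ...                                                   *)
Fixpoint RF (n : nat) : fieldType :=
  if n is n'.+1 then ({fraction {poly RF n'}} : fieldType) else (CC : fieldType).

Definition up_rf (n : nat) (x : RF n) : RF n.+1 := tofrac (x%:P).

Fixpoint emb (n : nat) : CC -> RF n :=
  if n is n'.+1 then fun c => up_rf (emb n' c) else fun c => c.

(* var n j = u_{j+1} in RF n (u_1 = var n 0 is the outermost variable) *)
Fixpoint var (n : nat) (j : nat) : RF n :=
  match n return RF n with
  | 0 => 0
  | n'.+1 => if j is j'.+1 then up_rf (var n' j') else tofrac ('X : {poly RF n'})
  end.

Definition ev_outer (n : nat) (x : RF n.+1) (a z : RF n) : Prop :=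
  exists p q : {poly RF n},
    q.[a] != 0 /\ x = tofrac p / tofrac q /\ z = p.[a] / q.[a].

Fixpoint eval_seq (n : nat) : RF n -> (nat -> CC) -> CC -> Prop :=
  match n return RF n -> (nat -> CC) -> CC -> Prop with
  | 0 => fun x sg c => x = c
  | n'.+1 => fun x sg c =>
      exists z : RF n', ev_outer x (emb n' (sg 0%N)) z /\
                        eval_seq z (fun i => sg i.+1) c
  end.

(* Hecke algebra H_m(r,s), via its universal property: A is any algebra
   over K = RF m and T : nat -> A, with T 1, ..., T (m-1) satisfying the
   defining relations of H_m(r,s) (scalars of C embedded in K).        *)
Section Hecke.
Variables (m : nat) (A : unitAlgType (RF m)) (T : nat -> A) (r s : CC).

Local Notation iota := (emb m).

Definition hecke_rels : Prop :=
  [/\ (forall i, (1 <= i)%N -> (i.+1 <= m.-1)%N ->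
         T i * T i.+1 * T i = T i.+1 * T i * T i.+1),
      (forall i j, (1 <= i <= m.-1)%N -> (1 <= j <= m.-1)%N ->
         (i.+1 < j)%N -> T i * T j = T j * T i) &
      (forall i, (1 <= i <= m.-1)%N ->
         (T i - 1) * (T i + (iota (r / s))%:A) = 0)].

Definition Tb (i : nat) (x y : RF m) : A :=
  iota s *: T i + ((iota s - iota r) / (y / x - 1))%:A.

Definition Tw (k : nat) : A :=
  \prod_(0 <= a < k.-1) \prod_(1 <= b < k - a) T b.

Definition u (j : nat) : RF m := var m j.-1.

Definition Psi : A :=
  (\prod_(1 <= k < m) \prod_(1 <= j < k.+1) Tb (k - j + 1) (u j) (u k.+1))
  * (Tw m)^-1.

Fixpoint jm (k : nat) : A :=
  match k with
  | 0 => 1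
  | k'.+1 => if k' is 0 then 1 else iota (s / r) *: (T k' * jm k' * T k')
  end.

Definition word (w : seq nat) : A := \prod_(i <- w) T i.

(* eval_alg X sg Y : the element X of A (an H_m-valued rational function
   of u_1..u_m) can be written as a K-linear combination of words in
   T_1..T_{m-1} whose coefficients can be consecutively evaluated at
   u_1 = sg 0, ..., u_m = sg (m-1); Y is the resulting value. *)
Definition eval_alg (X : A) (sg : nat -> CC) (Y : A) : Prop :=
  exists (n : nat) (c : 'I_n -> RF m) (v : 'I_n -> CC) (w : 'I_n -> seq nat),
    [/\ forall k, all (fun i => (1 <= i <= m.-1)%N) (w k),
        forall k, eval_seq (c k) sg (v k),
        X = \sum_(k < n) c k *: word (w k) &
        Y = \sum_(k < n) iota (v k) *: word (w k)].

End Hecke.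

(* Combinatorics.  Cells are pairs (i, j) = (row, column), 1-indexed.   *)
Definition cell := (nat * nat)%type.

Definition is_partition (m : nat) (lam : seq nat) : Prop :=
  [/\ sorted geq lam, all (fun x => (0 < x)%N) lam & sumn lam = m].

Definition in_diag (lam : seq nat) (c : cell) : bool :=
  (1 <= c.1 <= size lam)%N && (1 <= c.2 <= nth 0%N lam c.1.-1)%N.

Definition conjp (lam : seq nat) (j : nat) : nat := count (fun x => j <= x)%N lam.

(* t k = the cell containing k, for k = 1..m *)
Definition standard_tableau (m : nat) (lam : seq nat) (t : nat -> cell) : Prop :=
  [/\ forall k, (1 <= k <= m)%N -> in_diag lam (t k),
      forall k k', (1 <= k <= m)%N -> (1 <= k' <= m)%N -> t k = t k' -> k = k',
      forall c, in_diag lam c -> exists2 k, (1 <= k <= m)%N & t k = c,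
      forall k k', (1 <= k <= m)%N -> (1 <= k' <= m)%N ->
        (t k).1 = (t k').1 -> ((t k).2 < (t k').2)%N -> (k < k')%N &
      forall k k', (1 <= k <= m)%N -> (1 <= k' <= m)%N ->
        (t k).2 = (t k').2 -> ((t k).1 < (t k').1)%N -> (k < k')%N].

Definition content (r s : CC) (c : cell) : CC := (s / r) ^ (c.2%:Z - c.1%:Z).

Definition young (D : cell -> bool) : Prop :=
  forall i j, D (i, j) ->
    [/\ (1 <= i)%N, (1 <= j)%N, (1 < i)%N -> D (i.-1, j) & (1 < j)%N -> D (i, j.-1)].

Definition addable (D : cell -> bool) (c : cell) : Prop :=
  ~~ D c /\ young (fun x => D x || (x == c)).

Definition subshape (t : nat -> cell) (k : nat) (c : cell) : bool :=
  [exists i : 'I_k.+1, (0 < i)%N && (t i == c)].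

(* the idempotents E^lambda_T, defined inductively:
   Eidem k = E for the subtableau of entries 1..k.  The addable cells of
   the shape of entries 1..k-1 all lie in the box [1,m] x [1,m]. *)
Section Idem.
Variables (m : nat) (A : unitAlgType (RF m)) (T : nat -> A) (r s : CC)
          (t : nat -> cell).

Local Notation iota := (emb m).

Definition Efactor (k : nat) : A :=
  \prod_(1 <= i < m.+1) \prod_(1 <= j < m.+1 |
       `[< addable (subshape t k.-1) (i, j) >] && ((i, j) != t k))
     (iota ((content r s (t k) - content r s (i, j))^-1) *:
        (jm T r s k - (iota (content r s (i, j)))%:A)).

Fixpoint Eidem (k : nat) : A :=
  match k with
  | 0 => 1
  | k'.+1 => if k' is 0 then 1 else Eidem k' * Efactor k
  end.

End Idem.

Definition hook (lam : seq nat) (i j : nat) : nat :=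
  (nth 0%N lam i.-1 + conjp lam j + 1 - (i + j))%N.

Definition bconj (lam : seq nat) : nat := sumn [seq 'C(x, 2) | x <- lam].

Definition fnorm (r s : CC) (m : nat) (lam : seq nat) : CC :=
  (s / r) ^+ bconj lam * s ^- 'C(m, 2) * (1 - s / r) ^+ m *
  \prod_(1 <= i < (size lam).+1) \prod_(1 <= j < (nth 0%N lam i.-1).+1)
     (1 - (s / r) ^+ hook lam i j)^-1.

(* Main.v *)
Require Import Defs.
From HB Require Import structures.
From mathcomp Require Import all_boot all_order all_algebra.
From mathcomp Require Import complex Rstruct fraction boolp.
From mathcomp Require Import ring zify.
Import GRing.Theory.
Local Open Scope ring_scope.
Set Implicit Arguments.
Unset Strict Implicit.
Unset Printing Implicit Defensive.

(* Induction on the number n of evaluated variables: once u_1, ..., u_n are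
   specialised, the next block of Psi acts on the idempotent E of the first n
   entries as E (u - y)^-1 times a rational function of u = u_(n+1), where y is
   the next Jucys-Murphy element.  This comes from the rank-two affine Hecke
   relations, because E is a weight vector for the earlier Jucys-Murphy
   elements.  The weights of y on E are the contents of the addable cells, each
   with multiplicity one: an intertwiner argument leaves only these and the two
   neighbours of the last cell, and a non-addable neighbour is excluded by the
   braid relation.  Hence at u = sigma_(n+1) only the idempotent of the enlarged
   tableau survives.  The rational function is a product over the cells which
   telescopes along rows and columns to the ratio of hook products. *)

(** [A] is any algebra in which the relations hold: words in the [T i] may be linearly dependent,
    and no representation is at hand. Evaluation is therefore a relation between elements with
    matching expansions, and spectral facts are proved by showing that some vector, acted on from
    the right, is zero. Nor is u - y known to be invertible. Since y is annihilated by a product of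
    factors y - q^z and u is no power of q, u - y can be cancelled on the right, so identities with
    the resolvent are stated after multiplication by u - y. Let E and E' be the idempotents of the
    first n and n+1 entries. Then E' (u - y)^-1 = (u - sigma)^-1 E', while (E - E') (u - y)^-1 is
    regular at u = sigma, because multiplicity one leaves only the other addable contents as weights
    of E - E'. The scalar factor has a simple zero at sigma: it cancels the pole on E' and
    annihilates the rest. What remains of it, times s^n, is the ratio of the normalisations f for n
    and n+1 entries. *)

(** * Consecutive evaluation *)

Lemma tofrac_inj (R : idomainType) : injective (@tofrac R).
Proof. by move=> x y /eqP; rewrite tofrac_eq => /eqP. Qed.

Lemma up_rf_is_zmod n : zmod_morphism (@up_rf n).
Proof. by move=> x y; rewrite /up_rf polyCB rmorphB. Qed.
Lemma up_rf_is_monoid n : monoid_morphism (@up_rf n).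
Proof. by split=> [|x y]; rewrite /up_rf ?polyC1 ?rmorph1 // polyCM rmorphM. Qed.
HB.instance Definition _ n :=
  GRing.isZmodMorphism.Build (RF n) (RF n.+1) (@up_rf n) (@up_rf_is_zmod n).
HB.instance Definition _ n :=
  GRing.isMonoidMorphism.Build (RF n) (RF n.+1) (@up_rf n) (@up_rf_is_monoid n).

Lemma emb_is_zmod n : zmod_morphism (emb n).
Proof. by elim: n => [//|n IHn] x y /=; rewrite IHn rmorphB. Qed.
Lemma emb_is_monoid n : monoid_morphism (emb n).
Proof.
elim: n => [//|n [IH1 IHM]]; split=> [|x y] /=; first by rewrite IH1 rmorph1.
by rewrite IHM rmorphM.
Qed.
HB.instance Definition _ n := GRing.isZmodMorphism.Build CC (RF n) (emb n) (@emb_is_zmod n).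
HB.instance Definition _ n := GRing.isMonoidMorphism.Build CC (RF n) (emb n) (@emb_is_monoid n).

Lemma up_rf_inj n : injective (@up_rf n).
Proof. exact: fmorph_inj. Qed.

Lemma var_neq_emb n j c : (j < n)%N -> var n j != emb n c.
Proof.
elim: n j => [//|n IHn] [|j] /= lt_jn; last by rewrite (inj_eq (@up_rf_inj n)) IHn.
rewrite /up_rf (inj_eq (@tofrac_inj _)).
apply/eqP=> /(congr1 (fun p : {poly RF n} => size p)).
by rewrite size_polyX size_polyC; case: (_ == _).
Qed.

Section EvOuter.
Variables (n : nat) (a : RF n).
Implicit Types (x y : RF n.+1) (z w : RF n).

Lemma horner_neq0_tofrac (q : {poly RF n}) : q.[a] != 0 -> tofrac q != 0.
Proof. by apply: contraNneq => /eqP; rewrite tofrac_eq0 => /eqP->; rewrite horner0. Qed.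

Lemma ev_outer_fun x z w : ev_outer x a z -> ev_outer x a w -> z = w.
Proof.
case=> p [q [q0 [-> ->]]] [p' [q' [q0' [+ ->]]]].
move/eqP; rewrite eqr_div ?horner_neq0_tofrac // -!rmorphM /= (inj_eq (@tofrac_inj _)).
by move/eqP/(congr1 (horner^~ a)); rewrite !hornerM => /eqP; rewrite -eqr_div // => /eqP.
Qed.

Lemma ev_outer_up z : ev_outer (up_rf z) a z.
Proof.
exists z%:P, 1; split; first by rewrite hornerC oner_neq0.
by rewrite rmorph1 divr1 !hornerC divr1.
Qed.

Lemma ev_outerX : ev_outer (tofrac 'X) a a.
Proof.
exists 'X, 1; split; first by rewrite hornerC oner_neq0.
by rewrite rmorph1 divr1 hornerX hornerC divr1.
Qed.

Lemma ev_outerD x y z w :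
  ev_outer x a z -> ev_outer y a w -> ev_outer (x + y) a (z + w).
Proof.
case=> p [q [q0 [-> ->]]] [p' [q' [q0' [-> ->]]]].
exists (p * q' + p' * q), (q * q'); rewrite hornerM mulf_neq0 //; split=> //.
by rewrite !addf_div ?horner_neq0_tofrac // rmorphD !rmorphM /= hornerD !hornerM.
Qed.

Lemma ev_outerM x y z w :
  ev_outer x a z -> ev_outer y a w -> ev_outer (x * y) a (z * w).
Proof.
case=> p [q [q0 [-> ->]]] [p' [q' [q0' [-> ->]]]].
exists (p * p'), (q * q'); rewrite hornerM mulf_neq0 //; split=> //.
by rewrite !mulf_div !rmorphM /= hornerM.
Qed.

Lemma ev_outerV x z : z != 0 -> ev_outer x a z -> ev_outer x^-1 a z^-1.
Proof.
move=> + [p [q [q0 [-> zE]]]]; rewrite zE => z0; exists q, p.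
rewrite !invf_div; split=> //.
by apply: contraNneq z0 => ->; rewrite mul0r.
Qed.

End EvOuter.

(* [pe k x sg y]: the first [k] variables of [x] can be specialised to
   [sg 0, ..., sg k.-1] in turn; the value [y] is embedded back into the
   same field. *)
Fixpoint pe (k n : nat) : RF n -> (nat -> CC) -> RF n -> Prop :=
  match k, n return RF n -> (nat -> CC) -> RF n -> Prop with
  | k'.+1, n'.+1 => fun x sg y =>
      exists z z' : RF n', [/\ ev_outer x (emb n' (sg 0%N)) z,
        pe k' z (fun i => sg i.+1) z' & y = up_rf z']
  | _, _ => fun x _ y => x = y
  end.

Section Pe.
Implicit Types (sg : nat -> CC).

Lemma pe_emb k n sg c : pe k (emb n c) sg (emb n c).
Proof.
elim: k n sg => [//|k IHk] [//|n] sg /=.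
by exists (emb n c), (emb n c); split=> //; apply: ev_outer_up.
Qed.

Lemma peD k n (x y x' y' : RF n) sg :
  pe k x sg x' -> pe k y sg y' -> pe k (x + y) sg (x' + y').
Proof.
elim: k n sg x y x' y' => [|k IHk] [|n] sg x y x' y' /=; try by move=> -> ->.
move=> [z [z' [xz zz' ->]]] [w [w' [yw ww' ->]]].
exists (z + w), (z' + w'); split; last by rewrite rmorphD.
  exact: ev_outerD.
exact: IHk.
Qed.

Lemma peM k n (x y x' y' : RF n) sg :
  pe k x sg x' -> pe k y sg y' -> pe k (x * y) sg (x' * y').
Proof.
elim: k n sg x y x' y' => [|k IHk] [|n] sg x y x' y' /=; try by move=> -> ->.
move=> [z [z' [xz zz' ->]]] [w [w' [yw ww' ->]]].
exists (z * w), (z' * w'); split; last by rewrite rmorphM.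
  exact: ev_outerM.
exact: IHk.
Qed.

(** Used contrapositively in [peV]: a nonzero final value forces every intermediate value to be
    nonzero. *)
Lemma pe0l k n sg (y : RF n) : pe k 0 sg y -> y = 0.
Proof.
elim: k n sg y => [|k IHk] [|n] sg y //=.
case=> z [z' [ez]]; have -> : z = 0.
  apply: ev_outer_fun ez _; rewrite -(rmorph0 (@up_rf n)); exact: ev_outer_up.
by move=> /IHk -> ->; rewrite rmorph0.
Qed.

Lemma peV k n (x x' : RF n) sg : x' != 0 -> pe k x sg x' -> pe k x^-1 sg x'^-1.
Proof.
elim: k n sg x x' => [|k IHk] [|n] sg x x' /= x0; try by move=> ->.
move=> [z [z' [xz zz' x'E]]].
move: x0; rewrite x'E fmorph_eq0 => z'0.
exists z^-1, z'^-1; split; last by rewrite fmorphV.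
  apply: ev_outerV => //; apply: contraNneq z'0 => z0.
  by move: zz'; rewrite z0 => /pe0l->.
exact: IHk.
Qed.

Lemma pe0 k n sg : pe k (0 : RF n) sg 0.
Proof. by rewrite -(rmorph0 (emb n)); apply: pe_emb. Qed.
Lemma pe1 k n sg : pe k (1 : RF n) sg 1.
Proof. by rewrite -(rmorph1 (emb n)); apply: pe_emb. Qed.

Lemma peN k n (x x' : RF n) sg : pe k x sg x' -> pe k (- x) sg (- x').
Proof.
move=> xx'; rewrite -mulN1r -[X in pe _ _ _ X]mulN1r; apply: peM => //.
by rewrite -(rmorphN1 (emb n)); apply: pe_emb.
Qed.

Lemma peB k n (x y x' y' : RF n) sg :
  pe k x sg x' -> pe k y sg y' -> pe k (x - y) sg (x' - y').
Proof. by move=> xx' yy'; apply: peD => //; apply: peN. Qed.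

Lemma pe_div k n (x y x' y' : RF n) sg : y' != 0 ->
  pe k x sg x' -> pe k y sg y' -> pe k (x / y) sg (x' / y').
Proof. by move=> y'0 xx' yy'; apply: peM => //; apply: peV. Qed.

Lemma pe_prod k n (I : eqType) (l : seq I) (F G : I -> RF n) sg :
  (forall i, i \in l -> pe k (F i) sg (G i)) ->
  pe k (\prod_(i <- l) F i) sg (\prod_(i <- l) G i).
Proof.
move=> FG; rewrite 2!big_seq.
by apply: (big_ind2 (fun x y => pe k x sg y)) => // [|x x' y y']; [apply: pe1 | apply: peM].
Qed.

Lemma pe_var_lt k n j sg : (j < k)%N -> (j < n)%N -> pe k (var n j) sg (emb n (sg j)).
Proof.
elim: k n j sg => [//|k IHk] [//|n] [|j] sg /= lt_jk lt_jn.
  by exists (emb n (sg 0%N)), (emb n (sg 0%N)); split; [apply: ev_outerX | apply: pe_emb |].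
exists (var n j), (emb n (sg j.+1)); split=> //; first exact: ev_outer_up.
exact: (IHk n j (fun i => sg i.+1)).
Qed.

Lemma pe_var_ge k n j sg : (k <= j)%N -> pe k (var n j) sg (var n j).
Proof.
elim: k n j sg => [//|k IHk] [//|n] [//|j] sg /= le_kj.
by exists (var n j), (var n j); split=> //; [apply: ev_outer_up | apply: IHk].
Qed.

Lemma pe_idem k n (x y : RF n) sg : pe k x sg y -> pe k y sg y.
Proof.
elim: k n sg x y => [|k IHk] [|n] sg x y //=.
case=> z [z' [_ /IHk zz' ->]].
by exists z', z'; split=> //; apply: ev_outer_up.
Qed.

(** The value [y] no longer involves the first [k] variables, so specialising them again changes
    nothing. *)
Lemma pe_trans k n (x y z : RF n) sg :
  pe k x sg y -> pe k.+1 y sg z -> pe k.+1 x sg z.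
Proof.
elim: k n sg x y z => [|k IHk] [|n] sg x y z; try by move=> ->.
case=> z1 [z1' [xz1 z1z1' ->]] [w [w' [/ev_outer_fun wE ww' ->]]].
have {}wE := wE _ (ev_outer_up _ z1'); rewrite wE in ww'.
by exists z1, w'; split=> //; apply: IHk ww'.
Qed.

Lemma pe_eval_seq n (x : RF n) sg c : pe n x sg (emb n c) -> eval_seq x sg c.
Proof.
elim: n x sg => [//|n IHn] x sg /=.
case=> z [z' [xz zz' /up_rf_inj z'E]]; exists z; split=> //.
by apply: IHn; rewrite z'E.
Qed.

Lemma pe_const k m (x y : RF m) sg : (m <= k)%N -> pe k x sg y -> exists c, y = emb m c.
Proof.
elim: k m x sg y => [|k IHk] [|n] x sg y //=; try by exists y.
move=> le_nk [z [z' [_ /IHk zz' ->]]]; case: zz' => // c ->; by exists c.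
Qed.

End Pe.

(** * Consecutive evaluation of elements of the algebra *)

Section Pea.
Variables (m : nat) (A : unitAlgType (RF m)) (T : nat -> A) (sg : nat -> CC).

Definition valid_word (w : seq nat) := all (fun i => (1 <= i <= m.-1)%N) w.

(** One expansion over words serves both elements, and its coefficients are evaluated one by one.
    The relation is not claimed to be functional, since words may be dependent. Values stay in
    [RF m], so a partial evaluation lands in the same algebra. *)
Inductive pea (k : nat) : A -> A -> Prop :=
| pea_nil : pea k 0 0
| pea_cons c d w X Y of pe k c sg d & valid_word w & pea k X Y :
    pea k (c *: word T w + X) (d *: word T w + Y).

Lemma word_cat w w' : word T (w ++ w') = word T w * word T w'.
Proof. by rewrite /word big_cat. Qed.

Lemma peaD k X Y X' Y' : pea k X X' -> pea k Y Y' -> pea k (X + Y) (X' + Y').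
Proof.
elim=> [|c d w {}X {}X' cd vw _ IH] YY'; first by rewrite !add0r.
by rewrite -!addrA; apply: pea_cons => //; apply: IH.
Qed.

Lemma pea_scale_word k c d w X Y : pe k c sg d -> valid_word w -> pea k X Y ->
  pea k (c *: word T w * X) (d *: word T w * Y).
Proof.
move=> cd vw; elim=> [|c' d' w' {}X {}Y cd' vw' _ IH].
  by rewrite !mulr0; apply: pea_nil.
rewrite !mulrDr -!scalerAl -!scalerAr !scalerA -!word_cat.
apply: pea_cons; first exact: peM.
  by rewrite /valid_word all_cat; apply/andP.
by rewrite !scalerAl.
Qed.

Lemma peaM k X Y X' Y' : pea k X X' -> pea k Y Y' -> pea k (X * Y) (X' * Y').
Proof.
move=> XX' YY'; elim: XX' => [|c d w {}X {}X' cd vw _ IH].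
  by rewrite !mul0r; apply: pea_nil.
by rewrite !mulrDl; apply: peaD => //; apply: pea_scale_word.
Qed.

Lemma pea_alg k c d : pe k c sg d -> pea k c%:A d%:A.
Proof.
move=> cd; have := pea_cons cd (isT : valid_word [::]) (pea_nil k).
by rewrite /word big_nil !addr0.
Qed.

Lemma pea1 k : pea k 1 1.
Proof. by rewrite -(scale1r 1); apply/pea_alg/pe1. Qed.

Lemma peaZ k c d X Y : pe k c sg d -> pea k X Y -> pea k (c *: X) (d *: Y).
Proof.
move=> cd XY; rewrite -[X]mul1r -[Y]mul1r !scalerAl.
by apply: peaM => //; apply: pea_alg.
Qed.

Lemma peaN k X Y : pea k X Y -> pea k (- X) (- Y).
Proof. by rewrite -!scaleN1r => XY; apply: peaZ => //; apply/peN/pe1. Qed.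

Lemma peaB k X Y X' Y' : pea k X X' -> pea k Y Y' -> pea k (X - Y) (X' - Y').
Proof. by move=> XX' YY'; apply: peaD => //; apply: peaN. Qed.

Lemma pea_gen k i : (1 <= i <= m.-1)%N -> pea k (T i) (T i).
Proof.
move=> i_bd; have vw : valid_word [:: i] by rewrite /valid_word /= i_bd.
have := pea_cons (pe1 k m sg) vw (pea_nil k).
by rewrite /word big_seq1 !scale1r !addr0.
Qed.

Lemma pea_prod k (I : eqType) (r : seq I) (P : pred I) (F G : I -> A) :
  (forall i, i \in r -> P i -> pea k (F i) (G i)) ->
  pea k (\prod_(i <- r | P i) F i) (\prod_(i <- r | P i) G i).
Proof.
elim: r => [|i r IHr] FG; first by rewrite !big_nil; apply: pea1.
rewrite !big_cons; case: ifP => Pi; last by apply: IHr => j jr; apply: FG; rewrite inE jr orbT.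
apply: peaM; first by apply: FG; rewrite ?inE ?eqxx.
by apply: IHr => j jr; apply: FG; rewrite inE jr orbT.
Qed.

(* Subtracting from [X] the very combination of words that represents [Y]
   leaves coefficients that evaluate to 0; hence no linear independence of
   words is needed to change the representation between two evaluations. *)
Lemma pea_trans k X Y Z : pea k X Y -> pea k.+1 Y Z -> pea k.+1 X Z.
Proof.
move=> XY YZ; rewrite -[X](subrK Y) -[Z]add0r; apply: peaD => //.
elim: XY => [|c d w {YZ Z}X {}Y cd vw _ IH]; first by rewrite subr0; apply: pea_nil.
rewrite opprD addrACA -scalerBl -[0](addr0) -[X in pea _ _ (X + _)](scale0r (word T w)).
apply: pea_cons => //; apply: pe_trans (pe0 k.+1 m sg).
by rewrite -[X in pe _ _ _ X](subrr d); apply: peB => //; apply: pe_idem cd.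
Qed.

Lemma pea_eval_alg X Y : pea m X Y -> eval_alg T X sg Y.
Proof.
elim=> [|c d w {}X {}Y cd vw _ [n [c' [v' [w' [vw' ev XE YE]]]]]].
  exists 0%N, (fun _ => 0), (fun _ => 0), (fun _ => [::]).
  by split=> [[]|[]||] //; rewrite big_ord0.
have [v vE] := pe_const (leqnn m) cd.
have app (B : Type) (x : B) (f : 'I_n -> B) :
    exists g : 'I_n.+1 -> B, g ord0 = x /\ forall i, g (lift ord0 i) = f i.
  exists (fun j => oapp f x (unlift ord0 j)); split; first by rewrite unlift_none.
  by move=> i; rewrite liftK.
have [c1 [c10 c1S]] := app _ c c'; have [v1 [v10 v1S]] := app _ v v'.
have [w1 [w10 w1S]] := app _ w w'.
exists n.+1, c1, v1, w1; split.
- by move=> j; case: (unliftP ord0 j) => [i|] ->; rewrite ?w1S ?w10.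
- move=> j; case: (unliftP ord0 j) => [i|] ->; rewrite ?c1S ?v1S ?c10 ?v10 //.
  by apply: pe_eval_seq; rewrite -vE.
- rewrite big_ord_recl c10 w10 XE; congr (_ + _).
  by apply: eq_bigr => i _; rewrite c1S w1S.
rewrite big_ord_recl v10 w10 YE -vE; congr (_ + _).
by apply: eq_bigr => i _; rewrite v1S w1S.
Qed.

End Pea.

(** * Affine Hecke pairs and Jucys-Murphy elements *)

(* Reflexive decision procedure for linear identities in a module: it leaves
   the equalities of the coefficients of the atoms. *)
Section LinearReflection.
Variables (K : pzRingType) (V : lmodType K).

Inductive linexp :=
  | LinZero | LinVar of nat | LinAdd of linexp & linexp
  | LinOpp of linexp | LinScale of K & linexp.

Fixpoint lin_eval (env : seq V) (e : linexp) : V :=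
  match e with
  | LinZero => 0
  | LinVar i => nth 0 env i
  | LinAdd e1 e2 => lin_eval env e1 + lin_eval env e2
  | LinOpp e1 => - lin_eval env e1
  | LinScale a e1 => a *: lin_eval env e1
  end.

Fixpoint lin_coef (i : nat) (e : linexp) : K :=
  match e with
  | LinZero => 0
  | LinVar j => if Nat.eqb j i then 1 else 0
  | LinAdd e1 e2 => lin_coef i e1 + lin_coef i e2
  | LinOpp e1 => - lin_coef i e1
  | LinScale a e1 => a * lin_coef i e1
  end.

Fixpoint lin_same (e1 e2 : linexp) (n : nat) : Prop :=
  if n is n'.+1 then lin_coef n' e1 = lin_coef n' e2 /\ lin_same e1 e2 n' else True.

Lemma lin_evalE env e :
  lin_eval env e = \sum_(i < size env) lin_coef i e *: nth 0 env i.
Proof.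
elim: e => /= [|j|e1 -> e2 ->|e ->|a e ->].
- by rewrite big1 // => i _; rewrite scale0r.
- case: (ltnP j (size env)) => [lt_j|le_j].
    rewrite (bigD1 (Ordinal lt_j)) //= PeanoNat.Nat.eqb_refl scale1r big1 ?addr0 // => i.
    case: PeanoNat.Nat.eqb_spec => [ji|]; last by rewrite scale0r.
    by case/eqP; apply/val_inj.
  rewrite nth_default // big1 // => i _; case: PeanoNat.Nat.eqb_spec => [ji|].
    by have := ltn_ord i; rewrite -ji ltnNge le_j.
  by rewrite scale0r.
- by rewrite -big_split; apply: eq_bigr => i _; rewrite scalerDl.
- by rewrite -sumrN; apply: eq_bigr => i _; rewrite scaleNr.
by rewrite scaler_sumr; apply: eq_bigr => i _; rewrite scalerA.
Qed.

Lemma lin_sameP env e1 e2 :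
  lin_same e1 e2 (size env) -> lin_eval env e1 = lin_eval env e2.
Proof.
move=> e12; rewrite !lin_evalE; apply: eq_bigr => -[i /= lt_i] _; congr (_ *: _).
by elim: (size env) lt_i e12 => // n IHn; rewrite ltnS leq_eqVlt => /orP[/eqP->|/IHn IH] [].
Qed.
End LinearReflection.

(* Atoms are compared by unification, since equal products may carry
   different canonical instances. *)
Ltac lin_index v l :=
  match l with
  | ?x :: _ => let _ := match goal with _ => unify x v end in constr:(O)
  | _ :: ?l' => let n := lin_index v l' in constr:(S n)
  end.

Ltac lin_atoms t l :=
  lazymatch t with
  | (?a + ?b)%R => let l := lin_atoms a l in lin_atoms b l
  | (- ?a)%R => lin_atoms a l
  | (?c *: ?a)%R => lin_atoms a l
  | (0)%R => l
  | _ => match l with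
         | _ => let _ := lin_index t l in l
         | _ => constr:(t :: l)
         end
  end.

Ltac lin_reify K t l :=
  lazymatch t with
  | (?a + ?b)%R => let a := lin_reify K a l in let b := lin_reify K b l in
                   constr:(@LinAdd K a b)
  | (- ?a)%R => let a := lin_reify K a l in constr:(@LinOpp K a)
  | (?c *: ?a)%R => let a := lin_reify K a l in constr:(@LinScale K c a)
  | (0)%R => constr:(@LinZero K)
  | _ => let n := lin_index t l in constr:(@LinVar K n)
  end.

Ltac lin_split := lazymatch goal with
  | |- _ /\ _ => split; [| lin_split]
  | |- True => exact I
  | _ => idtac
  end.

Ltac linear K :=
  lazymatch goal with
  | |- ?x = ?y :> ?V =>
    let l := lin_atoms x (@nil V) in
    let l := lin_atoms y l in
    let e := lin_reify K x l in
    let f := lin_reify K y l in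
    refine (@lin_sameP _ _ l e f _);
    cbn [lin_same lin_coef size Nat.eqb]; lin_split
  end.

Ltac expand :=
  rewrite ?(mulrDl, mulrDr, mulrBl, mulrBr, mulNr, mulrN, mulr1, mul1r, opprD, opprK,
            scalerDr, scalerBr, scalerN, scalerA, mulrA, =^~ scalerAl, =^~ scalerAr).

Section HornerAlg.
Variables (K : fieldType) (A : algType K).
Implicit Types (v y : A) (p : {poly K}).

Lemma weight_horner v y a p : v * y = a *: v -> v * horner_alg y p = p.[a] *: v.
Proof.
move=> vy; elim/poly_ind: p => [|p c IHp]; first by rewrite rmorph0 mulr0 horner0 scale0r.
rewrite rmorphD rmorphM /= horner_algX horner_algC hornerMXaddC mulrDr mulrA IHp.
by rewrite -scalerAl vy scalerA -scalerAr mulr1 scalerDl.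
Qed.

Lemma intertwine_horner v y y' p :
  v * y = y' * v -> v * horner_alg y p = horner_alg y' p * v.
Proof.
move=> vy; elim/poly_ind: p => [|p c IHp]; first by rewrite !rmorph0 mulr0 mul0r.
rewrite !rmorphD !rmorphM /= !horner_algX !horner_algC mulrDr mulrDl mulrA IHp.
by rewrite -!mulrA vy -scalerAr -scalerAl mulr1 mul1r.
Qed.

Lemma comm_horner v y p : GRing.comm v y -> GRing.comm v (horner_alg y p).
Proof. exact: intertwine_horner. Qed.

Lemma horner_alg_XsubC y a : horner_alg y ('X - a%:P) = y - a%:A.
Proof. by rewrite rmorphB /= horner_algX horner_algC. Qed.

Lemma horner_algZ y a p : horner_alg y (a *: p) = a *: horner_alg y p.
Proof. by rewrite -mul_polyC rmorphM /= horner_algC -scalerAl mul1r. Qed.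

Lemma mulr_XsubC_eq0 v y a : v * horner_alg y ('X - a%:P) = 0 -> v * y = a *: v.
Proof. by rewrite horner_alg_XsubC mulrBr -scalerAr mulr1 => /eqP; rewrite subr_eq0 => /eqP. Qed.

Lemma commZ v y a : GRing.comm v y -> GRing.comm v (a *: y).
Proof. by rewrite /GRing.comm -scalerAr -scalerAl => ->. Qed.
End HornerAlg.

Lemma quadratic_inverse (K : fieldType) (A : algType K) (q : K) (x : A) : q != 0 ->
  x * x = (1 - q^-1) *: x + q^-1%:A ->
  x * (q *: x + (1 - q)%:A) = 1 /\ (q *: x + (1 - q)%:A) * x = 1.
Proof. by move=> q0 xx; split; expand; rewrite xx; linear K; field; rewrite ?q0. Qed.

(** * Rank-two affine Hecke relations *)

Section AffinePair.
Variables (K : fieldType) (A : algType K) (q : K) (T X X' : A).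
Hypothesis q0 : q != 0.
Hypothesis TT : T * T = (1 - q^-1) *: T + q^-1%:A.
Hypothesis X'E : X' = q *: (T * X * T).
Hypothesis XX' : X * X' = X' * X.
Let d := 1 - q^-1.

Lemma affine_X'T : X' * T = T * X + d *: X'.
Proof.
rewrite {1}X'E -scalerAl -[_ * T * T]mulrA TT mulrDr scalerDr addrC.
by rewrite -!scalerAr mulr1 !scalerA mulfV // scale1r [q * _]mulrC -scalerA -X'E.
Qed.

Lemma affine_TX' : T * X' = X * T + d *: X'.
Proof.
rewrite {1}X'E -scalerAr !mulrA TT !mulrDl scalerDr addrC.
by rewrite -!scalerAl !mul1r !scalerA mulfV // scale1r [q * _]mulrC -scalerA -X'E.
Qed.

(** The unnormalised intertwiner: right multiplication by it sends a joint eigenvector with weights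
    (a, b) for [X], [X'] to one with weights (b, a), or to zero. *)
Definition phi := T * X - X * T.

Lemma phi_X' : phi * X' = X * phi.
Proof.
have e1 : T * X * X' = X * T * X + d *: (X * X').
  by rewrite -mulrA XX' mulrA affine_TX' mulrDl -scalerAl -XX'.
have e2 : X * T * X' = X * X * T + d *: (X * X').
  by rewrite -mulrA affine_TX' mulrDr mulrA -scalerAr.
by rewrite /phi; expand; rewrite e1 e2; linear K; ring.
Qed.

Lemma X'_phi : X' * phi = phi * X.
Proof.
have e1 : X' * T * X = T * X * X + d *: (X * X').
  by rewrite affine_X'T mulrDl -scalerAl -XX'.
have e2 : X' * X * T = X * T * X + d *: (X * X').
  by rewrite -XX' -mulrA affine_X'T mulrDr mulrA -scalerAr.
by rewrite /phi; expand; rewrite e1 e2; linear K; ring.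
Qed.

(** As 2 q^-1 + d^2 = 1 + q^-2, the right-hand side is -q^-1 (X' - q X)(X' - q^-1 X), the form used
    in [phi_phi_weight]. *)
Lemma phi_phi : phi * phi =
  (q^-1 *+ 2 + d ^+ 2) *: (X * X') - q^-1 *: (X * X) - q^-1 *: (X' * X').
Proof.
have phiT : phi * T = q^-1 *: X' - d *: (X * T) - q^-1 *: X.
  rewrite /phi mulrBl -[X * T * T]mulrA TT mulrDr -!scalerAr mulr1.
  by rewrite X'E scalerA mulVf // scale1r opprD addrA.
have e1 : X' * X * T = X * T * X + d *: (X * X').
  by rewrite -XX' -mulrA affine_X'T mulrDr mulrA -scalerAr.
rewrite {2}/phi mulrBr !mulrA phiT -X'_phi -mulrA phiT.
by expand; rewrite e1; expand; rewrite -XX'; linear K; rewrite ?/d; ring.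
Qed.

Lemma X'_horner_phi p : horner_alg X' p * phi = phi * horner_alg X p.
Proof. by rewrite [RHS](intertwine_horner _ (esym X'_phi)). Qed.

(** The intertwiner turns p(X') phi into phi p(X), and [e] passes [phi] to meet p(X). With
    [phi_phi_weight] this confines [X'], on a vector of [X]-weight a, to the roots of [p] and to q
    a, q^-1 a. *)
Lemma affine_kill e p : GRing.comm e phi -> e * horner_alg X p = 0 ->
  e * horner_alg X' p * (phi * phi) = 0.
Proof.
move=> ephi ep; rewrite -mulrA [horner_alg X' p * _]mulrA X'_horner_phi.
by rewrite -[phi * _ * _]mulrA mulrA ephi -mulrA [e * _]mulrA ep mul0r mulr0.
Qed.

Lemma phi_phi_weight v a : v * X = a *: v ->
  v * (phi * phi) = (- q^-1) *: (v * horner_alg X' (('X - (q * a)%:P) * ('X - (q^-1 * a)%:P))).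
Proof.
move=> vX; rewrite phi_phi rmorphM /= !horner_alg_XsubC.
expand; rewrite vX; expand; rewrite vX.
by linear K; rewrite /d; field; rewrite ?q0.
Qed.

Lemma phi_phi_weight2 v a b : v * X = a *: v -> v * X' = b *: v ->
  v * (phi * phi) = (- q^-1 * (b - q * a) * (b - q^-1 * a)) *: v.
Proof.
move=> vX vX'; rewrite (phi_phi_weight vX) (weight_horner _ vX') !hornerE scalerA.
by congr (_ *: _); ring.
Qed.

Section Neighbour.
Variables (e v w : A) (p : {poly K}) (a b : K).
Hypotheses (eT : GRing.comm e T) (ep : e * horner_alg X p = 0).
Hypotheses (vE : v = w * e) (vX : v * X = a *: v) (vX' : v * X' = b *: v).

Let vTX : v * T * X = b *: (v * T) - (d * b) *: v.
Proof.
have -> : v * T * X = v * (X' * T) - d *: (v * X').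
  by rewrite affine_X'T; expand; linear K; ring.
by rewrite mulrA vX' -scalerAl scalerA.
Qed.

(** Since [e] commutes with [T], [v * T] is [w * T * e], so p(X) kills it just as it kills [v]. *)
Let neighbour_killed c : (v * T + c *: v) * horner_alg X p = 0.
Proof.
have ep' : v * horner_alg X p = 0 by rewrite vE -mulrA ep mulr0.
rewrite mulrDl -scalerAl ep' scaler0 addr0 vE -[w * e * T]mulrA eT.
by rewrite -!mulrA ep !mulr0.
Qed.

(** By [vTX], [v * T - v] is an eigenvector of [X] for [b]; it vanishes because p(X) kills it and
    [b] is no root. In [neighbour_col] the same holds for [v * T + q^-1 *: v]. *)
Lemma neighbour_row : a = q^-1 * b -> p.[b] != 0 -> v * T = v.
Proof.
move=> ab pb0; apply/eqP; rewrite -subr_eq0.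
have := neighbour_killed (-1); rewrite scaleN1r (@weight_horner _ _ _ _ b).
  by move/eqP; rewrite scaler_eq0 (negPf pb0).
by rewrite mulrBl vTX vX ab; linear K; rewrite /d; ring.
Qed.

Lemma neighbour_col : a = q * b -> p.[b] != 0 -> v * T = - q^-1 *: v.
Proof.
move=> ab pb0; apply/eqP; rewrite -subr_eq0 scaleNr opprK.
have := neighbour_killed q^-1; rewrite (@weight_horner _ _ _ _ b).
  by move/eqP; rewrite scaler_eq0 (negPf pb0).
by rewrite mulrDl -scalerAl vTX vX ab; linear K; rewrite /d; field; rewrite ?q0.
Qed.

(* If [X] and [X'] had the same eigenvalue on [v], then [X] would have a
   nontrivial Jordan block on the span of [v] and [v * T]. *)
Lemma weight_distinct : q != 1 -> a != 0 -> a = b ->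
  (exists2 p1 : {poly K}, p = ('X - a%:P) * p1 & p1.[a] != 0) -> v = 0.
Proof.
move=> q1 a0 ab [p1 pE p1a].
have dN0 : d * a != 0 by rewrite mulf_neq0 // subr_eq0 eq_sym invr_eq1.
(* Here [v * T * (X - a)] equals [- (d * a) *: v], so the vanishing leaves the nonzero multiple [d *
   a * p1.[a]] of [v]. *)
have := neighbour_killed 0; rewrite scale0r addr0 pE rmorphM /= horner_alg_XsubC mulrA mulrBr.
rewrite -scalerAr mulr1 vTX -ab addrC addKr mulNr -scalerAl (weight_horner _ vX).
rewrite scalerA => /eqP; rewrite oppr_eq0 scaler_eq0 (negPf (mulf_neq0 dN0 p1a)).
by move/eqP.
Qed.
End Neighbour.

Definition qroot_poly (L : seq int) : {poly K} := \prod_(z <- L) ('X - (q ^ z)%:P).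

Lemma qroot_poly_cons z L : qroot_poly (z :: L) = ('X - (q ^ z)%:P) * qroot_poly L.
Proof. by rewrite /qroot_poly big_cons. Qed.

(** On an [X]-eigenvector for q^z, the exponents in [L] together with z + 1 and z - 1 suffice for
    [X']. A general vector is treated by peeling off one root of its annihilator [M] at a time, [L]
    staying fixed. *)
Lemma affine_algebraic : (exists L, horner_alg X (qroot_poly L) = 0) ->
  exists L, horner_alg X' (qroot_poly L) = 0.
Proof.
case=> L pL.
have step v z : v * X = q ^ z *: v -> v * horner_alg X' (qroot_poly [:: z + 1, z - 1 & L]) = 0.
  move=> vX; have := @affine_kill 1 (qroot_poly L); rewrite !mul1r => /(_ _ pL).
  rewrite /GRing.comm mul1r mulr1 => /(_ erefl) kill.
  rewrite !qroot_poly_cons mulrA exprzDr ?exprzDr ?unitfE // expr1z mulrC.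
  rewrite [q ^ z * q]mulrC [q ^ z * _]mulrC rmorphM /= mulrA.
  have vY : v * horner_alg X' (qroot_poly L) * X = q ^ z *: (v * horner_alg X' (qroot_poly L)).
    by rewrite -mulrA -(comm_horner (qroot_poly L) XX') mulrA vX -scalerAl.
  have := phi_phi_weight vY; rewrite -!mulrA [horner_alg X' (qroot_poly L) * (phi * phi)]kill mulr0.
  by move/esym/eqP; rewrite scaler_eq0 oppr_eq0 invr_eq0 (negPf q0) => /eqP.
suff /(_ L)[L' kill] : forall M, exists L', forall v, v * horner_alg X (qroot_poly M) = 0 ->
    v * horner_alg X' (qroot_poly L') = 0.
  by exists L'; rewrite -[LHS]mul1r; apply: kill; rewrite mul1r.
elim=> [|z M [L' IHM]].
  by exists [::] => v; rewrite /qroot_poly big_nil rmorph1 mulr1 => ->; rewrite mul0r.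
exists (L' ++ [:: z + 1, z - 1 & L]) => v; rewrite qroot_poly_cons mulrC rmorphM /= mulrA => vM.
rewrite /qroot_poly big_cat -!/(qroot_poly _) rmorphM /= mulrA; apply: step; apply: mulr_XsubC_eq0.
rewrite -mulrA (comm_horner _ (esym (comm_horner _ XX'))).
rewrite mulrA; apply: IHM; rewrite -mulrA.
by rewrite -rmorphM /= mulrC rmorphM /= mulrA.
Qed.

(** This is the injectivity of right multiplication by u - y, which stands in for the resolvent. *)
Lemma qroot_poly_no_weight (v y : A) L u : horner_alg y (qroot_poly L) = 0 ->
  (forall z : int, u != q ^ z) -> v * y = u *: v -> v = 0.
Proof.
move=> pL uq vy; have := weight_horner (qroot_poly L) vy; rewrite pL mulr0.
move/esym/eqP; rewrite scaler_eq0 => /orP[|/eqP //].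
rewrite /qroot_poly horner_prod prodf_seq_eq0 => /hasP[z _ /=].
by rewrite !hornerE subr_eq0 (negPf (uq z)).
Qed.
End AffinePair.

(** * Jucys-Murphy elements of the Hecke algebra *)

Section Hecke.
Variables (K : fieldType) (A : algType K) (q : K).
Implicit Types (T : nat -> A) (N : nat).

Definition hecke N T : Prop :=
  [/\ forall i, (1 <= i <= N)%N -> T i * T i = (1 - q^-1) *: T i + q^-1%:A,
      forall i, (1 <= i < N)%N -> T i * T i.+1 * T i = T i.+1 * T i * T i.+1 &
      forall i j, (1 <= i <= N)%N -> (1 <= j <= N)%N -> (i.+1 < j)%N ->
        T i * T j = T j * T i].

Lemma hecke_far N T i j : hecke N T -> (1 <= i <= N)%N -> (1 <= j <= N)%N ->
  (i.+1 < j)%N || (j.+1 < i)%N -> T i * T j = T j * T i.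
Proof. by case=> _ _ far iN jN /orP[|] lt_ij; [|symmetry]; apply: far. Qed.

Lemma hecke_le M N T : (M <= N)%N -> hecke N T -> hecke M T.
Proof.
move=> le_MN [quad braid far]; split=> [i iM|i iM|i j iM jM lt_ij].
- by apply: quad; lia.
- by apply: braid; lia.
- by apply: far => //; lia.
Qed.

Lemma hecke_rev N T : hecke N T -> hecke N (fun i => T (N.+1 - i)%N).
Proof.
move=> hT; case: (hT) => [quad braid far]; split=> [i iN|i iN|i j iN jN lt_ij].
- by apply: quad; lia.
- have -> : (N.+1 - i = (N - i).+1)%N by lia.
  by rewrite subSS braid //; lia.
- by apply: hecke_far hT _ _ _; lia.
Qed.

Fixpoint JM T k : A :=
  if k is k'.+1 then if k' is 0%N then 1 else q *: (T k' * JM T k' * T k') else 1.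

Lemma JM1 T : JM T 1 = 1. Proof. by []. Qed.

Lemma JMS T k : (0 < k)%N -> JM T k.+1 = q *: (T k * JM T k * T k).
Proof. by case: k. Qed.

Lemma comm_JM_above T x k : (forall i, (1 <= i < k)%N -> GRing.comm x (T i)) ->
  GRing.comm x (JM T k).
Proof.
elim: k => [|[|k] IHk] xT; try exact: commr1.
rewrite [JM _ _]JMS //; apply: commZ; apply: commrM; last by apply: xT; lia.
by apply: commrM; [apply: xT; lia | apply: IHk => i ik; apply: xT; lia].
Qed.

Lemma comm_gen_JM_below N T i k : hecke N T -> (k < i <= N)%N -> GRing.comm (T i) (JM T k).
Proof.
move=> hT ki; apply: (@comm_JM_above T) => j jk.
by apply: hecke_far hT _ _ _; lia.
Qed.

(** The essential case is k = i + 2: the braid relation turns [T i] into [T i.+1] on its way through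
    the left generators, this commutes with [JM T i], and the right generators turn it back. *)
Lemma comm_gen_JM N T i k : hecke N T -> (1 <= i)%N -> (i.+1 < k <= N.+1)%N ->
  GRing.comm (T i) (JM T k).
Proof.
move=> hT i1; elim: k => // k IHk ik.
case: (ltnP i.+1 k) => [lt_ik|le_ki].
  rewrite JMS; last lia.
  have Tik : GRing.comm (T i) (T k) by apply: hecke_far hT _ _ _; lia.
  by apply: commZ; apply: commrM => //; apply: commrM => //; apply: IHk; lia.
have {ik le_ki IHk} [-> iN] : k = i.+1 /\ (i.+1 <= N)%N by lia.
case: (hT) => _ braid _; have br := braid i.
rewrite [JM _ _]JMS // [JM _ i.+1]JMS //; apply: commZ.
rewrite /GRing.comm !(=^~ scalerAr, =^~ scalerAl).
congr (_ *: _); rewrite !mulrA br; last lia.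
have Ty : T i.+1 * JM T i = JM T i * T i.+1 by apply: comm_gen_JM_below hT _; lia.
rewrite -[_ * T i.+1 * JM T i]mulrA Ty mulrA.
rewrite -[in RHS](mulrA _ (T i.+1) (T i)) -[in RHS](mulrA _ (T i) (T i.+1 * T i)).
rewrite [T i * (T i.+1 * T i)]mulrA br; last lia.
by rewrite !mulrA.
Qed.

Lemma comm_JM N T i k : hecke N T -> (i <= N.+1)%N -> (k <= N.+1)%N ->
  GRing.comm (JM T i) (JM T k).
Proof.
move=> hT; wlog le_ik : i k / (i <= k)%N.
  move=> wl iN kN; case/orP: (leq_total i k) => le; first exact: wl.
  exact/commr_sym/wl.
move=> iN kN; have [->//|lt_ik] : i = k \/ (i < k)%N by lia.
apply: commr_sym; apply: (@comm_JM_above _) => j ji; apply: commr_sym.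
by apply: comm_gen_JM hT _ _; lia.
Qed.

Lemma comm_JM_pair N T k : hecke N T -> (1 <= k <= N)%N ->
  JM T k * JM T k.+1 = JM T k.+1 * JM T k.
Proof. by move=> hT kN; apply: comm_JM hT _ _; lia. Qed.

Hypothesis q0 : q != 0.

Lemma JM_algebraic N T k : hecke N T -> (1 <= k <= N.+1)%N ->
  exists L, horner_alg (JM T k) (qroot_poly q L) = 0.
Proof.
move=> hT; elim: k => // -[_ _|k IHk kN].
  by exists [:: 0]; rewrite /qroot_poly big_seq1 horner_alg_XsubC expr0z scale1r subrr.
have [quad _ _] := hT.
apply: affine_algebraic (JMS _ _) (comm_JM_pair hT _) (IHk _) => //; first by apply: quad; lia.
  by lia.
Qed.
End Hecke.
Arguments JM : simpl never.

(** * The fusion product *)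

Section Fusion.
Variables (K : fieldType) (A : algType K) (q : K).
Implicit Types (T S : nat -> A) (N : nat).
Local Notation JM := (JM q).
Local Notation hecke := (hecke q).

Definition up_prod T k : A := \prod_(1 <= i < k) T i.
Definition down_prod T k : A := \prod_(1 <= i < k) T (k - i)%N.

Lemma up_prodS T k : (0 < k)%N -> up_prod T k.+1 = up_prod T k * T k.
Proof. by move=> k0; rewrite /up_prod big_nat_recr. Qed.

Lemma down_prodS T k : (0 < k)%N -> down_prod T k.+1 = T k * down_prod T k.
Proof.
by move=> k0; rewrite /down_prod big_nat_recl // subn1.
Qed.

Lemma down_prodE T k : down_prod T k = up_prod (fun i => T (k - i)%N) k.
Proof. by []. Qed.

Lemma up_prodE T k : up_prod T k = down_prod (fun i => T (k - i)%N) k.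
Proof. by apply: eq_big_nat => i ik; congr T; lia. Qed.

Lemma comm_up_prod T x k :
  (forall i, (1 <= i < k)%N -> GRing.comm x (T i)) -> GRing.comm x (up_prod T k).
Proof.
rewrite /up_prod => xT; rewrite big_seq; apply: (big_ind (fun z => GRing.comm x z)).
- exact: commr1.
- exact: commrM.
- by move=> i; rewrite mem_index_iota; apply: xT.
Qed.

Lemma up_prod_gen N T k i : hecke N T -> (1 <= i)%N -> (i.+1 < k <= N.+1)%N ->
  up_prod T k * T i = T i.+1 * up_prod T k.
Proof.
move=> hT i1; elim: k => // k IHk ik; rewrite !up_prodS; try lia.
case: (ltnP i.+1 k) => [lt_ik|le_ki].
  have -> : up_prod T k * T k * T i = up_prod T k * T i * T k.
    by rewrite -!mulrA; congr (_ * _); apply: hecke_far hT _ _ _; lia.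
  by rewrite IHk ?mulrA //; lia.
have {ik le_ki IHk} [-> iN] : k = i.+1 /\ (i.+1 <= N)%N by lia.
case: (hT) => _ braid _; rewrite up_prodS // -!mulrA [T i * (_ * _)]mulrA braid; last lia.
rewrite !mulrA; congr (_ * _ * _); symmetry; apply: comm_up_prod => j ji.
by apply: hecke_far hT _ _ _; lia.
Qed.

Lemma up_prod_JM N T k j : hecke N T -> (j < k <= N.+1)%N ->
  up_prod T k * JM T j = JM (fun i => T i.+1) j * up_prod T k.
Proof.
move=> hT; elim: j => [|[|j] IHj] jk; rewrite ?mulr1 ?mul1r //.
rewrite [JM T _]JMS // [JM (fun i => T i.+1) _]JMS // -scalerAr -scalerAl; congr (_ *: _).
have upT := up_prod_gen hT (ltn0Sn j) (_ : j.+2 < k <= N.+1)%N.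
rewrite !mulrA upT ?jk // -[_ * _ * JM T _]mulrA.
rewrite IHj; last lia.
by rewrite -!mulrA upT.
Qed.

Lemma JM_prodE T k : (0 < k)%N -> JM T k = q ^+ k.-1 *: (down_prod T k * up_prod T k).
Proof.
elim: k => // -[_ _|k IHk _].
  by rewrite /down_prod /up_prod !big_geq // mulr1 scale1r.
rewrite JMS // IHk // [down_prod T k.+2]down_prodS // [up_prod T k.+2]up_prodS //.
rewrite -scalerAr -scalerAl scalerA -exprS.
by rewrite !mulrA.
Qed.

Hypothesis q0 : q != 0.

(* The eigenvalues of [F] under the shifted Jucys-Murphy elements make the
   product of Baxterised generators telescope to a resolvent. *)
Lemma fusion_step N S (F : A) (sigma : nat -> K) (u : K) : hecke N S ->
  (forall z : int, u != q ^ z) ->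
  (forall k, (1 <= k <= N)%N -> sigma k != 0 /\ u != sigma k) ->
  (forall k, (1 <= k <= N)%N -> F * JM (fun i => S i.+1) k = sigma k *: F) ->
  forall k, (k <= N)%N ->
  F * (\prod_(1 <= i < k.+1) (S i + ((1 - q^-1) / (u / sigma i - 1))%:A))
    * (u%:A - JM S k.+1) =
  ((u - 1) * \prod_(1 <= i < k.+1)
     ((u - q * sigma i) * (u - q^-1 * sigma i) / (u - sigma i) ^+ 2)) *:
  (F * up_prod S k.+1).
Proof.
move=> hS uq sigmaP FJ; elim=> [_|k IHk lt_kN].
  by rewrite /up_prod !big_geq // !mulr1 JM1 mulrBr -scalerAr !mulr1 scalerBl scale1r.
have {IHk}WX := IHk (ltnW lt_kN).
rewrite big_nat_recr //= [X in _ = (_ * X) *: _]big_nat_recr //= [up_prod S k.+2]up_prodS //.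
rewrite [F * (_ * _)]mulrA [(u - 1) * (_ * _)]mulrA.
move: WX; set W := F * \prod_(_ <= _ < _) _; set g := (u - 1) * _ => WX; clearbody W g.
have [s0 us] := sigmaP k.+1 lt_kN.
have XX' := comm_JM_pair hS (lt_kN : (1 <= k.+1 <= N)%N).
have [quad _ _] := hS.
have TX' := affine_TX' q0 (quad k.+1 lt_kN) (JMS q S (ltn0Sn k)).
have TT := quad k.+1 lt_kN.
have X'E := JMS q S (ltn0Sn k).
have [L pL] := JM_algebraic q0 hS (ltnW lt_kN : (1 <= k.+1 <= N.+1)%N).
have FcTX : F * up_prod S k.+1 * S k.+1 * JM S k.+1 =
            sigma k.+1 *: (F * up_prod S k.+1 * S k.+1).
  rewrite -[F * up_prod S k.+1 * _]mulrA -up_prodS // -mulrA (up_prod_JM hS) ?ltnSn //.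
  by rewrite mulrA FJ // -scalerAl.
move: (JM S k.+1) (JM S k.+2) (S k.+1) (up_prod S k.+1) (sigma k.+1) => X X' T c s
  in XX' TX' TT X'E pL FcTX s0 us WX *.
have us0 : u - s != 0 by rewrite subr_eq0.
have FcX' : F * c * X' = s *: ((q - 1) *: (F * c * T) + F * c).
  rewrite X'E -scalerAr !mulrA FcTX -!scalerAl -[F * c * T * T]mulrA TT.
  by expand; linear K; field; rewrite ?q0.
(* [Y] is computed by multiplying it by u - X: as [X] and [X'] commute, this gives g F c (s - X'),
   which [FcX'] reduces to a multiple of F c T, an eigenvector of [X] for [s]. Cancelling u - X is
   legitimate because u is no power of q. *)
pose Y := s *: W - W * X'.
have YE : Y = (g * s * (1 - q) / (u - s)) *: (F * c * T).
  apply/eqP; rewrite -subr_eq0; apply/eqP.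
  apply: (qroot_poly_no_weight pL uq); apply/eqP; rewrite eq_sym -subr_eq0; apply/eqP.
  transitivity ((g *: (F * c)) * (s%:A - X') -
     (g * s * (1 - q) / (u - s)) *: ((u - s) *: (F * c * T))).
    rewrite -WX /Y; expand; rewrite FcTX -[W * X * X']mulrA XX' mulrA.
    by linear K; ring.
  by expand; rewrite FcX'; expand; linear K; field; rewrite ?us0 ?q0.
(* Moving [X'] to the left of [T] by [TX'] produces W (u - X) T, known by induction; all other terms
   combine into a multiple of [Y]. *)
transitivity (g *: (F * c) * T + ((1 - q^-1) * u / (u - s)) *: Y).
  rewrite -WX /Y; expand; rewrite -[W * T * X']mulrA TX'; expand.
  by linear K; field; rewrite ?us0 ?s0 ?q0.
by rewrite YE; expand; linear K; field; rewrite ?us0 ?q0.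
Qed.

End Fusion.

(** * Conjugation by the longest element *)

Section LongestElement.
Variables (K : fieldType) (A : algType K) (q : K).
Implicit Types (T : nat -> A) (N : nat).
Local Notation JM := (JM q).
Local Notation hecke := (hecke q).

Fixpoint longest T k : A := if k is k'.+1 then up_prod T k * longest T k' else 1.

Lemma longestS T k : longest T k.+1 = up_prod T k.+1 * longest T k.
Proof. by []. Qed.

Lemma comm_longest T x k :
  (forall i, (1 <= i < k)%N -> GRing.comm x (T i)) -> GRing.comm x (longest T k).
Proof.
elim: k => [|k IHk] xT; first exact: commr1.
rewrite longestS; apply: commrM; first exact: comm_up_prod.
by apply: IHk => i ik; apply: xT; lia.
Qed.

(** The second factorisation of the longest element: its inverse splits off the inverse of the
    smaller one on the right, as the recursion for [Psi_upto] requires. *)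
Lemma longestSr N T k : hecke N T -> (k <= N)%N ->
  longest T k.+1 = longest T k * down_prod T k.+1.
Proof.
move=> hT; elim: k => [_|k IHk lt_kN].
  by rewrite /= /up_prod /down_prod !big_geq // mulr1.
rewrite [LHS]longestS [in LHS]IHk ?(ltnW lt_kN) // [up_prod T _]up_prodS //.
rewrite [down_prod T k.+2]down_prodS // [in RHS]longestS.
rewrite -!mulrA; congr (_ * _); rewrite [T k.+1 * _]mulrA [longest T k * _ in RHS]mulrA.
congr (_ * _); apply: comm_longest => i ik; apply: hecke_far hT _ _ _; lia.
Qed.

Lemma down_prod_gen N T k i : hecke N T -> (1 <= i)%N -> (i.+1 < k <= N.+1)%N ->
  down_prod T k * T i.+1 = T i * down_prod T k.
Proof.
move=> hT i1 ik; rewrite down_prodE.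
case: k ik => // k ik; have hR := hecke_rev (hecke_le (_ : k <= N)%N hT).
have e1 : (k.+1 - (k - i))%N = i.+1 by lia.
have e2 : (k.+1 - (k - i).+1)%N = i by lia.
have := @up_prod_gen _ _ _ _ _ k.+1 (k - i) (hR _); cbv beta; rewrite e1 e2.
by apply; lia.
Qed.

(** For i > 1 the generator passes the left block of [longestS] with its index lowered. [T 1] cannot
    do so, and there the right block of [longestSr] is used. *)
Lemma gen_longest N T k i : hecke N T -> (k <= N.+1)%N -> (1 <= i < k)%N ->
  T i * longest T k = longest T k * T (k - i)%N.
Proof.
move=> hT; elim: k i => [|k IHk] i le_kN ik; first lia.
have [i1|i_gt1] : i = 1%N \/ (1 < i)%N by lia.
  rewrite i1 in ik *; rewrite (longestSr hT) // subSS subn0.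
  case: k IHk le_kN ik => [|[|k]] IHk le_kN ik; first lia.
    by rewrite /= down_prodS // /up_prod /down_prod !big_geq // !(mulr1, mul1r).
  rewrite mulrA IHk; [|lia|lia]; rewrite -!mulrA; congr (_ * _).
  by rewrite subSS subn0 (down_prod_gen hT) //; lia.
rewrite longestS mulrA; case: i i_gt1 ik => // i i1 ik.
rewrite -(up_prod_gen hT) //; last lia.
rewrite -!mulrA IHk; [by rewrite subSS|lia|lia].
Qed.

Lemma JM_longest N T n j : hecke N T -> (n <= N.+1)%N -> (j <= n)%N ->
  JM T j * longest T n = longest T n * JM (fun i => T (n - i)%N) j.
Proof.
move=> hT le_nN; elim: j => [|[|j] IHj] le_jn; rewrite ?mulr1 ?mul1r //.
rewrite [JM T _]JMS // [JM (fun i => T (n - i)%N) _]JMS // -scalerAr -scalerAl; congr (_ *: _).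
rewrite -!mulrA (gen_longest hT) //.
by rewrite [JM T _ * _]mulrA IHj ?(ltnW le_jn) // !mulrA (gen_longest hT).
Qed.

(** By [JM_prodE] the element is a power of q times down times up. Reversing the generators
    exchanges the two products, so both sides are that power times down, up, down. *)
Lemma JM_down_prod T n :
  JM T n.+1 * down_prod T n.+1 = down_prod T n.+1 * JM (fun i => T (n.+1 - i)%N) n.+1.
Proof.
rewrite !JM_prodE // -scalerAl -scalerAr -!mulrA; congr (_ *: (_ * _)).
by rewrite -up_prodE -down_prodE.
Qed.

Hypothesis q0 : q != 0.
Variables (N n : nat) (T : nat -> A) (E dinv linv : A) (sigma : nat -> K) (u : K).
Hypotheses (hT : hecke N T) (lt_nN : (n <= N)%N).
Hypotheses (uq : forall z : int, u != q ^ z)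
  (sigmaP : forall k, (1 <= k <= n)%N -> sigma k != 0 /\ u != sigma k)
  (EJ : forall k, (1 <= k <= n)%N -> E * JM T k = sigma k *: E).
Hypotheses (dinvP : down_prod T n.+1 * dinv = 1) (dinvPl : dinv * down_prod T n.+1 = 1).
Hypotheses (linvP : longest T n * linv = 1) (linvPl : linv * longest T n = 1).

Lemma fusion_resolvent :
  E * (longest T n
       * \prod_(1 <= j < n.+1) (T (n.+1 - j)%N + ((1 - q^-1) / (u / sigma j - 1))%:A)
       * dinv * linv)
    * (u%:A - JM T n.+1) =
  ((u - 1) * \prod_(1 <= i < n.+1)
     ((u - q * sigma i) * (u - q^-1 * sigma i) / (u - sigma i) ^+ 2)) *: E.
Proof.
(* The generators are reversed so that the block reads in increasing order. [S i.+1] is then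
   [T (n - i)], the conjugate of [T i] by the longest element, hence [E * longest T n] is the vector
   [F] of [fusion_step]. *)
pose S i := T (n.+1 - i)%N; have hS : hecke n S := hecke_rev (hecke_le lt_nN hT).
have FJ k : (1 <= k <= n)%N -> E * longest T n * JM (fun i => S i.+1) k =
    sigma k *: (E * longest T n).
  move=> kn; rewrite -mulrA -(JM_longest hT) ?mulrA ?EJ -?scalerAl //; lia.
have := fusion_step q0 hS uq sigmaP FJ (leqnn n).
rewrite -[up_prod S _]down_prodE; set B := \prod_(_ <= _ < _) _; set g := (u - 1) * _.
have ly : linv * JM T n.+1 = JM T n.+1 * linv.
  have : longest T n * JM T n.+1 = JM T n.+1 * longest T n.
    apply: commr_sym; apply: comm_longest => i ik; apply: commr_sym.
    by apply: comm_gen_JM hT _ _; lia.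
  move/(congr1 (fun z => linv * z * linv)); rewrite !mulrA linvPl mul1r => ->.
  by rewrite -!mulrA linvP mulr1.
have dy : dinv * JM T n.+1 = JM S n.+1 * dinv.
  have := JM_down_prod T n; move/(congr1 (fun z => dinv * z * dinv)).
  by rewrite !mulrA dinvPl mul1r -!mulrA dinvP mulr1.
have commute : dinv * linv * (u%:A - JM T n.+1) = (u%:A - JM S n.+1) * dinv * linv.
  rewrite mulrBr -[_ * JM T _]mulrA ly mulrA dy -scalerAr mulr1 !mulrBl -!scalerAl mul1r.
  by [].
move=> fus; rewrite -!mulrA [dinv * _]mulrA commute !mulrA fus -!scalerAl.
by rewrite -(mulrA E) -!mulrA [down_prod T _ * _]mulrA dinvP mul1r linvP mulr1.
Qed.

End LongestElement.

(** [B] plays the part of (E - E') (u - y)^-1. The zero u - sigma cancels the pole on [E'] and stays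
    in front of [B]. *)
Lemma resolvent_split (K : fieldType) (A : algType K) (E E' B y : A) (a u sigma : K) :
  B * (u%:A - y) = E - E' -> E' * y = sigma *: E' ->
  (a *: (E' + (u - sigma) *: B)) * (u%:A - y) = (a * (u - sigma)) *: E.
Proof.
move=> BE Ey; rewrite -scalerAl mulrDl -scalerAl BE mulrBr Ey.
by expand; linear K; ring.
Qed.

Lemma no_weight_eq (K : fieldType) (A : algType K) (q u : K) (L : seq int) (v w y : A) :
  horner_alg y (qroot_poly q L) = 0 -> (forall z : int, u != q ^ z) ->
  v * (u%:A - y) = w * (u%:A - y) -> v = w.
Proof.
move=> yL uq /eqP; rewrite -subr_eq0 -mulrBl mulrBr -scalerAr mulr1 subr_eq0 => /eqP e.
by apply/eqP; rewrite -subr_eq0; apply/eqP; apply: (qroot_poly_no_weight yL uq).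
Qed.

(** * Growth of Young diagrams *)

Section Tableaux.
Implicit Types (D : cell -> bool) (c : cell) (t : nat -> cell).

Definition diagonal c : int := c.2%:Z - c.1%:Z.

Lemma subshapeP t k c :
  reflect (exists2 i, (1 <= i <= k)%N & t i = c) (subshape t k c).
Proof.
apply: (iffP existsP) => [[i /andP[i0 /eqP ti]]|[i ik ti]].
  by exists i => //; have := ltn_ord i; lia.
have lt_i : (i < k.+1)%N by lia.
by exists (Ordinal lt_i); rewrite /= ti eqxx; lia.
Qed.

Lemma subshape0 t c : subshape t 0 c = false.
Proof. by apply/subshapeP => -[l]; lia. Qed.

Lemma subshapeS t k c : subshape t k.+1 c = subshape t k c || (c == t k.+1).
Proof.
apply/subshapeP/orP => [[i ik <-]|[/subshapeP[i ik <-]|/eqP->]].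
- have [->|le_ik] : i = k.+1 \/ (i <= k)%N by lia.
    by right.
  by left; apply/subshapeP; exists i => //; lia.
- by exists i => //; lia.
- by exists k.+1 => //; lia.
Qed.

Lemma eq_young D D' : D =1 D' -> young D -> young D'.
Proof. by move=> DD' yD i j; rewrite -!DD' => /yD. Qed.

Lemma young_down D i j i' j' : young D -> D (i, j) ->
  (1 <= i' <= i)%N -> (1 <= j' <= j)%N -> D (i', j').
Proof.
move=> yD; have up i1 j1 : D (i1, j1) -> (1 <= i' <= i1)%N -> D (i', j1).
  elim: i1 => [|i1 IH] Dij ii; first lia.
  have [->//|le] : i' = i1.+1 \/ (i' <= i1)%N by lia.
  by apply: IH; [case: (yD _ _ Dij) => _ _ + _; apply; lia | lia].
have left i1 j1 : D (i1, j1) -> (1 <= j' <= j1)%N -> D (i1, j').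
  elim: j1 => [|j1 IH] Dij jj; first lia.
  have [->//|le] : j' = j1.+1 \/ (j' <= j1)%N by lia.
  by apply: IH; [case: (yD _ _ Dij) => _ _ _; apply; lia | lia].
by move=> Dij ii jj; apply: up ii; apply: left Dij jj.
Qed.

Lemma addable_ge1 D c : addable D c -> (1 <= c.1)%N && (1 <= c.2)%N.
Proof. by case: c => i j [_ /(_ i j)]; rewrite eqxx orbT => /(_ isT)[-> ->]. Qed.

Lemma addable_up D i j : addable D (i, j) -> (1 < i)%N -> D (i.-1, j).
Proof.
move=> [_ /(_ i j)]; rewrite eqxx orbT => /(_ isT)[_ _ + _] i1 => /(_ i1).
by case/orP=> // /eqP[]; lia.
Qed.

Lemma addable_left D i j : addable D (i, j) -> (1 < j)%N -> D (i, j.-1).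
Proof.
move=> [_ /(_ i j)]; rewrite eqxx orbT => /(_ isT)[_ _ _ +] j1 => /(_ j1).
by case/orP=> // /eqP[]; lia.
Qed.

Lemma addableI D i j : young D -> ~~ D (i, j) -> (1 <= i)%N -> (1 <= j)%N ->
  ((1 < i)%N -> D (i.-1, j)) -> ((1 < j)%N -> D (i, j.-1)) -> addable D (i, j).
Proof.
move=> yD ND i0 j0 up left; split=> // i' j' /orP[|/eqP[-> ->]].
  by case/yD=> -> -> up' left'; split=> // [/up'|/left'] ->.
by split=> // [/up|/left] ->.
Qed.

Lemma addable_antichain D c c' : addable D c -> addable D c' -> c != c' ->
  (c.1 < c'.1)%N && (c'.2 < c.2)%N || (c'.1 < c.1)%N && (c.2 < c'.2)%N.
Proof.
have below (a b : cell) : addable D a -> addable D b -> (a.1 <= b.1)%N -> (a.2 <= b.2)%N ->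
    a = b.
  case: a b => i j [i' j'] aA /= aB ii jj; case: (aA) (aB) => ND _ [_ yD].
  have /andP[i0 j0] := addable_ge1 aA.
  have Db : D (i', j') || ((i', j') == (i', j')) by rewrite eqxx orbT.
  have := young_down yD Db (_ : 1 <= i <= i')%N (_ : 1 <= j <= j')%N.
  by rewrite (negPf ND) i0 j0 ii jj => /(_ isT isT)/eqP.
move=> ac ac' cc'; have [n1|lt1] := leqP c.1 c'.1; last first.
  have [lt2|n2] := ltnP c.2 c'.2; first by rewrite orbT.
  by rewrite (below _ _ ac' ac (ltnW lt1) n2) eqxx in cc'.
have [n2|lt2] := leqP c.2 c'.2.
  by rewrite (below _ _ ac ac' n1 n2) eqxx in cc'.
have [lt1|n1'] := ltnP c.1 c'.1; first by [].
by rewrite (below _ _ ac' ac n1' (ltnW lt2)) eqxx in cc'.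
Qed.

(** Of two addable cells one is strictly above and strictly to the right of the other, so both
    coordinates contribute. A gap of at least 2 separates the contents and also keeps their
    neighbours q^(d+1), q^(d-1) off the spectrum. *)
Lemma addable_diagonal D c c' : addable D c -> addable D c' -> c != c' ->
  (2 <= `|diagonal c - diagonal c'|)%N.
Proof. by move=> ac ac' /(addable_antichain ac ac'); rewrite /diagonal; lia. Qed.

Lemma addable_setU D c c' : addable D c -> addable D c' -> c != c' ->
  addable (fun x => D x || (x == c')) c.
Proof.
move=> [ND yc] [_ yc'] cc'; split; first by rewrite negb_or ND.
move=> i j /orP[/orP[Dij|ij]|ij].
- case: (yc i j); rewrite ?Dij // => i0 j0 up left.
  by split=> // [/up|/left] /orP[] ->; rewrite ?orbT.
- case: (yc' i j); rewrite ?ij ?orbT // => i0 j0 up left.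
  by split=> // [/up|/left] /orP[] ->; rewrite ?orbT.
- case: (yc i j); rewrite ?ij ?orbT // => i0 j0 up left.
  by split=> // [/up|/left] /orP[] ->; rewrite ?orbT.
Qed.

Lemma eq_addable D D' c : D =1 D' -> addable D c -> addable D' c.
Proof. by move=> /funext ->. Qed.

(** Standardness without reference to a final shape, which makes restriction to initial segments and
    swapping of entries easy. *)
Definition growth t n := forall k, (1 <= k <= n)%N -> addable (subshape t k.-1) (t k).

Lemma growth_le t m n : (m <= n)%N -> growth t n -> growth t m.
Proof. by move=> le_mn gt k km; apply: gt; lia. Qed.

Lemma growth_young t n k : growth t n -> (k <= n)%N -> young (subshape t k).
Proof.
move=> gt; case: k => [_ i j|k lt_kn]; first by rewrite subshape0.
by have [_] := gt k.+1 lt_kn; apply: eq_young => c; rewrite subshapeS.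
Qed.

Lemma growth_notin t n k : growth t n -> (1 <= k <= n)%N -> ~~ subshape t k.-1 (t k).
Proof. by move=> gt /gt[]. Qed.

Lemma subshape_le t k l c : (k <= l)%N -> subshape t k c -> subshape t l c.
Proof. by move=> le_kl /subshapeP[i ik ti]; apply/subshapeP; exists i => //; lia. Qed.

Lemma growth_inj t n k l : growth t n -> (1 <= k <= n)%N -> (1 <= l <= n)%N ->
  t k = t l -> k = l.
Proof.
move=> gt; wlog lt_kl : k l / (k < l)%N.
  move=> wl kn ln tkl; have [lt|lt|//] := ltngtP k l; first exact: wl.
  by symmetry; apply: wl.
move=> kn ln tkl; have /subshapeP[] := growth_notin gt ln.
by exists k; rewrite ?tkl //; lia.
Qed.

Lemma addable_box t k c : growth t k -> addable (subshape t k) c -> (c.1 + c.2 <= k.+2)%N.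
Proof.
elim: k {-2}k (leqnn k) c => [|n IHn] k le_kn [i j] gt ac /=.
  have k0 : k = 0%N by lia.
  rewrite k0 in ac; have /= /andP[i0 j0] := addable_ge1 ac.
  case: (ltnP 1 i) => [/(addable_up ac)|]; first by rewrite subshape0.
  by case: (ltnP 1 j) => [/(addable_left ac)|]; [rewrite subshape0 | lia].
have bound a b : subshape t k (a, b) -> (a + b <= k.+1)%N.
  case/subshapeP=> l lk tl; have := gt l lk; rewrite tl => /IHn /=.
  by move/(_ (_ : (l.-1 <= n)%N) (growth_le _ gt)); rewrite -!subn1; lia.
have /= /andP[i0 j0] := addable_ge1 ac.
case: (ltnP 1 i) => [i1|]; first by have := bound _ _ (addable_up ac i1); lia.
by case: (ltnP 1 j) => [j1|]; [have := bound _ _ (addable_left ac j1); lia | lia].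
Qed.

Definition swap p t k := t (if k == p then p.+1 else if k == p.+1 then p else k).

Lemma swapK p t : swap p (swap p t) = t.
Proof.
apply/funext=> k; rewrite /swap; congr t.
have [->|kp] := eqVneq k p; first by rewrite eqxx gtn_eqF.
have [->|kp1] := eqVneq k p.+1; first by rewrite eqxx.
by rewrite (negPf kp) (negPf kp1).
Qed.

Lemma swap_l p t : swap p t p = t p.+1. Proof. by rewrite /swap eqxx. Qed.
Lemma swap_r p t : swap p t p.+1 = t p.
Proof. by rewrite /swap eqxx gtn_eqF. Qed.
Lemma swap_id p t k : k != p -> k != p.+1 -> swap p t k = t k.
Proof. by rewrite /swap => /negPf-> /negPf->. Qed.

Lemma subshape_swap p t k : (1 <= p)%N -> k != p -> subshape (swap p t) k =1 subshape t k.
Proof.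
move=> p1 kp c; apply/subshapeP/subshapeP => -[i ik <-].
  by rewrite /swap; case: eqP => [ip|_]; [|case: eqP => [ip|_]];
     [exists p.+1|exists p|exists i] => //; lia.
exists (if i == p then p.+1 else if i == p.+1 then p else i).
  by case: eqP => [ip|_]; [|case: eqP => [ip|_]]; lia.
by have := swapK p t => /(congr1 (fun f => f i)).
Qed.

Lemma growth_swap p t n : growth t n -> (1 <= p < n)%N ->
  addable (subshape t p.-1) (t p.+1) -> growth (swap p t) n.
Proof.
move=> gt pn ap k kn; have tp : (1 <= p <= n)%N by lia.
have [->|kp] := eqVneq k p.
  rewrite swap_l; apply: eq_addable ap => c; rewrite subshape_swap //; lia.
have [->|kp1] := eqVneq k p.+1; last first.
  by rewrite swap_id //; apply: eq_addable (gt k kn) => c; rewrite subshape_swap //; lia.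
rewrite swap_r /=; have neq : t p != t p.+1.
  by apply/eqP => /(growth_inj gt tp (_ : 1 <= p.+1 <= n)%N); lia.
apply: eq_addable (addable_setU (gt p tp) ap neq) => c.
case: p pn {ap tp kp} neq => // p pn neq; rewrite [RHS]subshapeS swap_l /=.
by rewrite subshape_swap //; lia.
Qed.

(** The box has side N + 1; for N = m - 1 it is the one in [Efactor], and by [addable_box] it
    contains all addable cells when k <= N. *)
Definition addables N t k : seq cell :=
  [seq c <- [seq (i, j) | i <- index_iota 1 N.+2, j <- index_iota 1 N.+2]
     | `[< addable (subshape t k) c >]].

Lemma addables_uniq N t k : uniq (addables N t k).
Proof.
apply: filter_uniq; apply: allpairs_uniq; rewrite ?iota_uniq // => -[a b] [a' b'] _ _ /=.
by case=> -> ->.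
Qed.

Lemma mem_addables N t k c : growth t k -> (k <= N)%N ->
  reflect (addable (subshape t k) c) (c \in addables N t k).
Proof.
move=> gt kN; rewrite mem_filter; apply: (iffP andP) => [[/asboolP //]|ac].
split; first exact/asboolP.
have le2 := addable_box gt ac; have ge1 := addable_ge1 ac.
case: c ge1 le2 {ac} => i j ge1 le2; apply/allpairsP; exists (i, j).
by rewrite !mem_index_iota; split=> //=; move: ge1 le2; rewrite /=; lia.
Qed.

End Tableaux.

(** * Spectrum of the Jucys-Murphy elements *)

Lemma prod_subseq (K : comPzRingType) (I : eqType) (s1 s2 : seq I) (F : I -> K) :
  uniq s1 -> uniq s2 -> {subset s1 <= s2} ->
  \prod_(i <- s2) F i = \prod_(i <- s1) F i * \prod_(i <- s2 | i \notin s1) F i.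
Proof.
move=> u1 u2 s12; rewrite (bigID (mem s1)) /=; congr (_ * _).
rewrite -big_filter; apply: perm_big; apply: uniq_perm; rewrite ?filter_uniq // => i.
by rewrite mem_filter; case: (boolP (i \in s1)) => // /s12 ->.
Qed.

Section Spectrum.
Variables (K : fieldType) (A : algType K) (q : K) (N : nat) (T : nat -> A).
Hypotheses (q0 : q != 0) (q_generic : forall z : int, q ^ z = 1 -> z = 0).
Hypothesis hT : hecke q N T.
Implicit Types (t : nat -> cell) (c : cell).
Local Notation y := (JM q T).
Local Notation M := N.+1.
Local Notation addables := (addables N).

Definition qcontent c : K := q ^ diagonal c.

Lemma qexpz_inj : injective (exprz q).
Proof.
move=> a b qab; apply/eqP; rewrite -subr_eq0; apply/eqP/q_generic.
by rewrite expfzDr // qab -expfzDr // subrr expr0z.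
Qed.

Lemma qexpz_eq (a b : int) : (q ^ a == q ^ b) = (a == b).
Proof. by apply/eqP/eqP => [/qexpz_inj|->]. Qed.

Lemma qexpzD1 (z : int) : q * q ^ z = q ^ (z + 1).
Proof. by rewrite expfzDr // expr1z mulrC. Qed.

Lemma qexpzB1 (z : int) : q^-1 * q ^ z = q ^ (z - 1).
Proof. by rewrite expfzDr // -invr_expz expr1z mulrC. Qed.

Lemma q_neq1 : q != 1.
Proof. by apply/eqP => q1; have := @q_generic 1; rewrite expr1z => /(_ q1). Qed.

Lemma q_neqN1 : q != -1.
Proof.
by apply/eqP => q1; have := @q_generic 2; rewrite -exprnP q1 sqrrN expr1n => /(_ erefl).
Qed.

Lemma qcontent_neq0 c : qcontent c != 0.
Proof. exact: expfz_neq0. Qed.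

Definition add_poly t k : {poly K} := \prod_(c <- addables t k) ('X - (qcontent c)%:P).

Definition interp_poly t k : {poly K} := \prod_(c <- addables t k.-1 | c != t k)
  ((qcontent (t k) - qcontent c)^-1 *: ('X - (qcontent c)%:P)).

Lemma qcontent_addable D c c' : addable D c -> addable D c' -> qcontent c = qcontent c' ->
  c = c'.
Proof.
move=> ac ac' /qexpz_inj dd; apply/eqP; case: eqVneq => // /(addable_diagonal ac ac').
by rewrite dd subrr.
Qed.

Section GrowthStep.
Variables (t : nat -> cell) (k : nat).
Hypotheses (gt : growth t k.+1) (le_kN : (k <= N)%N).

Let ac : addable (subshape t k) (t k.+1).
Proof. exact: (gt (leqnn k.+1 : (1 <= k.+1 <= k.+1)%N)). Qed.
Let gk : growth t k. Proof. exact: growth_le gt. Qed.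

Lemma addables_last : t k.+1 \in addables t k.
Proof. exact/mem_addables. Qed.

Let qdiff c : c \in addables t k -> c != t k.+1 -> qcontent (t k.+1) - qcontent c != 0.
Proof.
move=> /mem_addables aC; apply: contraNneq => /eqP; rewrite subr_eq0 => /eqP e.
by rewrite (qcontent_addable ac (aC _ _) e).
Qed.

Lemma interp_poly_last : (interp_poly t k.+1).[qcontent (t k.+1)] = 1.
Proof.
rewrite /interp_poly horner_prod big_seq_cond big1 // => c /andP[ck cN].
by rewrite !hornerE mulVf ?qdiff.
Qed.

Lemma add_polyE : exists2 a, a != 0 &
  add_poly t k = a *: (('X - (qcontent (t k.+1))%:P) * interp_poly t k.+1).
Proof.
exists (\prod_(c <- addables t k | c != t k.+1) (qcontent (t k.+1) - qcontent c)).
  by rewrite prodf_seq_neq0; apply/allP => c ck; apply/implyP; apply: qdiff.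
rewrite /add_poly (bigD1_seq _ addables_last (addables_uniq N t k)) /= scalerAr; congr (_ * _).
rewrite /interp_poly /= -scaler_prod big_seq_cond [RHS]big_seq_cond.
by apply: eq_bigr => c /andP[ck cN]; rewrite scalerA mulfV ?qdiff // scale1r.
Qed.

Lemma add_poly_neighbour (d : int) : `|d|%N = 1%N ->
  (add_poly t k).[q ^ (diagonal (t k.+1) + d)] != 0.
Proof.
move=> d1; rewrite /add_poly horner_prod prodf_seq_neq0; apply/allP => c /mem_addables aC /=.
rewrite !hornerE subr_eq0 qexpz_eq.
have [->|/(addable_diagonal (aC gk le_kN) ac)] := eqVneq c (t k.+1); lia.
Qed.

End GrowthStep.

Fixpoint idem t n : A :=
  if n is n'.+1 then idem t n' * horner_alg (y n) (interp_poly t n) else 1.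

Lemma idemS t n : idem t n.+1 = idem t n * horner_alg (y n.+1) (interp_poly t n.+1).
Proof. by []. Qed.

Lemma comm_idem x t n :
  (forall k, (1 <= k <= n)%N -> GRing.comm x (y k)) -> GRing.comm x (idem t n).
Proof.
elim: n => [|n IHn] xy; first exact: commr1.
rewrite idemS; apply: commrM; first by apply: IHn => k kn; apply: xy; lia.
by apply: comm_horner; apply: xy; lia.
Qed.

Lemma comm_y i k : (i <= M)%N -> (k <= M)%N -> GRing.comm (y i) (y k).
Proof. exact: comm_JM hT. Qed.

Lemma comm_y_idem i t n : (i <= M)%N -> (n <= M)%N -> GRing.comm (y i) (idem t n).
Proof. by move=> iM nM; apply: comm_idem => k kn; apply: comm_y; lia. Qed.

Lemma comm_gen_idem i t n : (1 <= i <= N)%N -> (n < i)%N -> GRing.comm (T i) (idem t n).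
Proof. by move=> iN lt_ni; apply: comm_idem => k kn; apply: comm_gen_JM_below hT _; lia. Qed.

Lemma weight_idem (W : A) t n : growth t n -> (n <= M)%N ->
  (forall k, (1 <= k <= n)%N -> W * y k = qcontent (t k) *: W) -> W * idem t n = W.
Proof.
elim: n => [|n IHn] gt nM Wy; first exact: mulr1.
rewrite idemS mulrA IHn; [|exact: growth_le gt|lia|]; last by move=> k kn; apply: Wy; lia.
by rewrite (weight_horner _ (Wy _ _)) ?leqnn // interp_poly_last ?scale1r.
Qed.

(** The factors of [add_poly] are distinct, so this says that on the idempotent [y n.+1] has only
    addable contents as weights and no Jordan block. *)
Definition spectral n := forall t, growth t n -> idem t n * horner_alg (y n.+1) (add_poly t n) = 0.

Lemma idem_weight t n : (n <= M)%N -> (forall k, (k < n)%N -> spectral k) -> growth t n ->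
  forall k, (1 <= k <= n)%N -> idem t n * y k = qcontent (t k) *: idem t n.
Proof.
elim: n => [|n IHn] nM spec gt k kn; first lia.
have gtn : growth t n := growth_le (leqnSn n) gt.
have [->|kn'] : k = n.+1 \/ (1 <= k <= n)%N by lia.
  have := spec n (ltnSn n) t gtn.
  have [a a0 ->] := add_polyE gt nM; rewrite horner_algZ -scalerAr mulrC => /eqP.
  rewrite scaler_eq0 (negPf a0) /= rmorphM /= mulrA -idemS => /eqP.
  exact: mulr_XsubC_eq0.
rewrite idemS -mulrA -(comm_horner _ (comm_y _ _)) //; [|lia].
by rewrite mulrA IHn // ?scalerAl //; [lia | move=> l ln; apply: spec; lia].
Qed.

(* Swapping two nonadjacent consecutive entries: the intertwiner carries the
   weight of [t] to that of [swap p t], and squares to a nonzero scalar. *)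
Lemma swap_kill t n p (Q : {poly K}) : (n <= N)%N -> (forall k, (k < n)%N -> spectral k) ->
  growth t n -> (1 <= p < n)%N -> addable (subshape t p.-1) (t p.+1) ->
  idem (swap p t) n * horner_alg (y n.+1) Q = 0 -> idem t n * horner_alg (y n.+1) Q = 0.
Proof.
move=> nN spec gt pn ap EQ0.
have pN : (1 <= p <= N)%N by lia.
have [quad _ _] := hT.
have XX' := comm_JM_pair hT pN; have TT := quad p pN.
have X'E : y p.+1 = q *: (T p * y p * T p) by rewrite JMS //; lia.
have wt k : (1 <= k <= n)%N -> idem t n * y k = qcontent (t k) *: idem t n.
  by apply: idem_weight => //; lia.
pose f := phi (T p) (y p).
have fX' : f * y p.+1 = y p * f := phi_X' q0 TT X'E XX'.
have fX : y p.+1 * f = f * y p := X'_phi q0 TT X'E XX'.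
have fy k : (1 <= k <= M)%N -> k != p -> k != p.+1 -> GRing.comm f (y k).
  move=> kM kp kp1; apply: commr_sym; rewrite /f /phi.
  have Ty : GRing.comm (y k) (T p).
    apply: commr_sym; have [lt|le] := ltnP k p; first by apply: comm_gen_JM_below hT _; lia.
    by apply: comm_gen_JM hT _ _; lia.
  by apply: commrB; apply: commrM => //; apply: comm_y; lia.
have tpN : (1 <= p <= n)%N by lia.
have tp1N : (1 <= p.+1 <= n)%N by lia.
have := phi_phi_weight2 q0 TT X'E XX' (wt p tpN) (wt p.+1 tp1N); rewrite -/f.
(* Both cells are addable to the shape of the first p - 1 entries, so their diagonals differ by at
   least 2 and neither factor of the square vanishes. *)
set a := _ * _ * _; have a0 : a != 0.
  have neq : t p.+1 != t p by apply/eqP => /(growth_inj gt tp1N tpN); lia.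
  have := addable_diagonal ap (gt p tpN) neq.
  rewrite /a !mulf_eq0 oppr_eq0 invr_eq0 (negPf q0) !subr_eq0 /qcontent.
  by rewrite !(qexpzD1, qexpzB1) !qexpz_eq; lia.
move=> ff; have wW k : (1 <= k <= n)%N ->
    idem t n * f * y k = qcontent (swap p t k) *: (idem t n * f).
  move=> kn; have [->|kp] := eqVneq k p.
    by rewrite swap_l -mulrA -fX mulrA wt // -scalerAl.
  have [->|kp1] := eqVneq k p.+1.
    by rewrite swap_r -mulrA fX' mulrA wt // -scalerAl.
  rewrite swap_id // -mulrA fy ?mulrA ?wt // -?scalerAl //; lia.
have WE := weight_idem (growth_swap gt pn ap) (leqW nN) wW.
have fh : f * horner_alg (y n.+1) Q = horner_alg (y n.+1) Q * f.
  by apply: comm_horner; apply: fy; lia.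
(* The multiple by [a] is [idem t n * f], then Q, then [f]; by [WE] the idempotent of [swap p t] may
   be inserted before Q. *)
apply: (scalerI a0); rewrite scaler0 scalerAl -ff -2!mulrA fh [f * _]mulrA.
by rewrite [LHS]mulrA mulrA -WE -[_ * idem _ _ * _]mulrA EQ0 mulr0 mul0r.
Qed.

Lemma swap_kill_iff t n p (Q : {poly K}) : (n <= N)%N -> (forall k, (k < n)%N -> spectral k) ->
  growth t n -> (1 <= p < n)%N -> addable (subshape t p.-1) (t p.+1) ->
  idem (swap p t) n * horner_alg (y n.+1) Q = 0 <-> idem t n * horner_alg (y n.+1) Q = 0.
Proof.
move=> nN spec gt pn ap; split; first exact: swap_kill.
rewrite -{1}(swapK p t); apply: swap_kill => //; first exact: growth_swap.
rewrite swap_r; apply: eq_addable (gt p _); last lia.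
by move=> c; rewrite subshape_swap //; lia.
Qed.

(** A corner of the shape of the first n - 1 entries has no neighbour there to its right or below.
    So its entry can be exchanged with the next one until it is n - 1; entry n never moves, and each
    swap preserves annihilation. *)
Lemma corner_last t n c : (n <= N)%N -> (forall k, (k < n)%N -> spectral k) ->
  growth t n -> subshape t n.-1 c ->
  ~~ subshape t n.-1 (c.1, c.2.+1) -> ~~ subshape t n.-1 (c.1.+1, c.2) ->
  exists t', [/\ growth t' n, t' n = t n, t' n.-1 = c &
    forall Q, idem t' n * horner_alg (y n.+1) Q = 0 <-> idem t n * horner_alg (y n.+1) Q = 0].
Proof.
move=> nN spec + /subshapeP[p pn tp]; move E : (n.-1 - p)%N => d.
elim: d p t E pn tp => [|d IHd] p t E pn tp gt Nright Ndown.
  by exists t; split=> //; rewrite -tp; congr t; lia.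
have tpn : (1 <= p <= n)%N by lia.
have tpn1 : (1 <= p.+1 <= n)%N by lia.
have ap : addable (subshape t p.-1) (t p.+1).
  have := gt p.+1 tpn1; have : subshape t n.-1 (t p.+1) by apply/subshapeP; exists p.+1 => //; lia.
  case: (t p.+1) => i j tin /= ac; have /= /andP[i0 j0] := addable_ge1 ac.
  have yD : young (subshape t p.-1) by apply: growth_young gt _; lia.
  have mono x : subshape t p x -> x != c -> subshape t p.-1 x.
    by case: p pn tp {E tpn tpn1 ac yD} => // p pn tp; rewrite subshapeS tp => /orP[|->].
  apply: addableI => //.
  - by case: ac => Nin _; apply: contra Nin; apply: subshape_le; lia.
  - move=> i1; apply: mono (addable_up ac i1) _; apply: contraNneq Ndown => <- /=.
    by rewrite prednK.
  move=> j1; apply: mono (addable_left ac j1) _; apply: contraNneq Nright => <- /=.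
  by rewrite prednK.
have gs := growth_swap gt (_ : 1 <= p < n)%N ap.
have [||||||t' [gt' tn tn1 kill]] := IHd p.+1 (swap p t).
- by lia.
- by lia.
- by rewrite swap_r.
- by apply: gs; lia.
- by rewrite subshape_swap //; lia.
- by rewrite subshape_swap //; lia.
exists t'; split=> // [|Q]; first by rewrite tn swap_id //; lia.
by rewrite kill swap_kill_iff //; lia.
Qed.

(** The weights of [v] at n - 1, n, n + 1 would be a q^d, a, a q^d. By the neighbour lemmas [T n.-1]
    and [T n] then act by 1 and -q^-1 in some order; the braid relation would force these to be
    equal, contrary to q != -1. *)
Lemma braid_kill t n (d : int) Q v : (1 < n <= N)%N -> (forall k, (k < n)%N -> spectral k) ->
  growth t n -> `|d|%N = 1%N -> diagonal (t n.-1) = diagonal (t n) + d ->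
  v = idem t n * horner_alg (y n.+1) Q ->
  v * y n.+1 = q ^ (diagonal (t n) + d) *: v -> v = 0.
Proof.
case: n => [|[|n]] // nN spec gt d1 dd vE vy2.
have [quad braid _] := hT.
have quad1 := quad n.+1 (ltnW nN); have quad2 := quad n.+2 nN.
have vy k : (1 <= k <= n.+2)%N -> v * y k = qcontent (t k) *: v.
  move=> kn; rewrite vE -mulrA -(comm_horner _ (comm_y _ _)) //; try lia.
  by rewrite mulrA (idem_weight _ spec) // ?scalerAl //; lia.
have vy0 := vy n.+1 (ltnW (ltnSn _)); have vy1 := vy n.+2 (leqnn _).
have comm_idem_horner i k p : (i <= M)%N -> (k <= M)%N ->
    GRing.comm (idem t i) (horner_alg (y k) p).
  by move=> iM kM; apply: comm_horner; apply: commr_sym; apply: comm_y_idem.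
have [w1 E1] : exists w, v = w * idem t n.+1.
  exists (horner_alg (y n.+2) (interp_poly t n.+2) * horner_alg (y n.+3) Q).
  by rewrite vE idemS -mulrA; apply: commrM; apply: comm_idem_horner; lia.
have [w0 E0] : exists w, v = w * idem t n.
  exists (horner_alg (y n.+1) (interp_poly t n.+1) *
    (horner_alg (y n.+2) (interp_poly t n.+2) * horner_alg (y n.+3) Q)).
  rewrite vE 2!idemS -2!mulrA.
  by apply: commrM; [|apply: commrM]; apply: comm_idem_horner; lia.
have gt1 := growth_le (leqnSn _) gt; have gt0 := growth_le (leqnSn _) gt1.
have k1 := spec n.+1 (ltnSn _) t gt1; have k0 := spec n (ltnW (ltnSn _)) t gt0.
have X2E : y n.+3 = q *: (T n.+2 * y n.+2 * T n.+2) by rewrite JMS.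
have X1E : y n.+2 = q *: (T n.+1 * y n.+1 * T n.+1) by rewrite JMS.
have eT1 : GRing.comm (idem t n.+1) (T n.+2).
  by apply: commr_sym; apply: comm_gen_idem; lia.
have eT0 : GRing.comm (idem t n) (T n.+1).
  by apply: commr_sym; apply: comm_gen_idem; lia.
have p1 := add_poly_neighbour gt (ltnW nN) d1.
have d1' : `|- d|%N = 1%N by rewrite abszN.
have p0 := add_poly_neighbour gt1 (ltnW (ltnW nN)) d1'.
rewrite /= in dd; have dd' : diagonal (t n.+1) + - d = diagonal (t n.+2) by rewrite dd addrK.
rewrite dd' -/(qcontent _) in p0.
have r2 := neighbour_row q0 quad2 X2E eT1 k1 E1 vy1 vy2.
have c2 := neighbour_col q0 quad2 X2E eT1 k1 E1 vy1 vy2.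
have r1 := neighbour_row q0 quad1 X1E eT0 k0 E0 vy0 vy1.
have c1 := neighbour_col q0 quad1 X1E eT0 k0 E0 vy0 vy1.
have qq : (- q^-1 - 1 : K) != 0.
  rewrite subr_eq0 eqr_oppLR; apply/eqP => qN; have /eqP := q_neqN1; apply.
  by rewrite -[q]invrK qN invrN1.
have br a b : v * T n.+1 = a *: v -> v * T n.+2 = b *: v -> (a * b * (a - b)) *: v = 0.
  move=> va vb; have := congr1 (fun z => v * z) (braid n.+1 nN).
  rewrite !mulrA va vb -!scalerAl va vb -!scalerAl va vb !scalerA -mulrA => /eqP.
  rewrite -subr_eq0 -scalerBl => /eqP <-; congr (_ *: _); ring.
have scal_neq0 : - q^-1 * (- q^-1 - 1) != 0 by rewrite mulf_neq0 // oppr_eq0 invr_eq0.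
have [d_1|d_N1] : d = 1 \/ d = -1 by lia.
  have v1 : v * T n.+1 = - q^-1 *: v.
    by apply: c1 p0; rewrite /qcontent dd d_1 qexpzD1.
  have v2 : v * T n.+2 = 1 *: v.
    by rewrite scale1r; apply: r2 p1; rewrite d_1 qexpzB1 addrK.
  have := br _ _ v1 v2; rewrite mulr1 => /eqP.
  by rewrite scaler_eq0 (negPf scal_neq0) => /eqP.
have v1 : v * T n.+1 = 1 *: v.
  by rewrite scale1r; apply: r1 p0; rewrite /qcontent dd d_N1 qexpzB1.
have v2 : v * T n.+2 = - q^-1 *: v.
  by apply: c2 p1; rewrite d_N1 qexpzD1 subrK.
have := br _ _ v1 v2; rewrite mul1r -opprB mulrN scaleNr => /eqP.
by rewrite oppr_eq0 scaler_eq0 (negPf scal_neq0) => /eqP.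
Qed.

(** A factor is moved to the end, where the vector before it would have a forbidden weight and so is
    already zero. That vector involves all other factors, hence the quantification over Q. *)
Lemma horner_filter (e z : A) (L : seq cell) (good : pred cell) :
  (forall c, c \in L -> ~~ good c -> forall Q, e * horner_alg z Q * z =
     qcontent c *: (e * horner_alg z Q) -> e * horner_alg z Q = 0) ->
  e * horner_alg z (\prod_(c <- L) ('X - (qcontent c)%:P)) = 0 ->
  e * horner_alg z (\prod_(c <- L | good c) ('X - (qcontent c)%:P)) = 0.
Proof.
move=> kill; suff gen Q : e * horner_alg z (Q * \prod_(c <- L) ('X - (qcontent c)%:P)) = 0 ->
    e * horner_alg z (Q * \prod_(c <- L | good c) ('X - (qcontent c)%:P)) = 0.
  by have := gen 1; rewrite !mul1r.
elim: L Q kill => [|c L IHL] Q kill; first by rewrite !big_nil.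
have {}IHL := IHL _ (fun c' c'L => kill c' (mem_behead (c'L : c' \in behead (c :: L)))).
rewrite !big_cons; case: ifP => gc; first by rewrite !mulrA; apply: IHL.
rewrite mulrCA mulrC => cQ; apply: IHL.
apply: (kill c (mem_head _ _)); first by rewrite gc.
by apply: mulr_XsubC_eq0; rewrite -mulrA -rmorphM.
Qed.

Lemma corner_kill t n c (d : int) Q : (n <= N)%N -> (forall k, (k < n)%N -> spectral k) ->
  growth t n -> subshape t n.-1 c ->
  ~~ subshape t n.-1 (c.1, c.2.+1) -> ~~ subshape t n.-1 (c.1.+1, c.2) ->
  `|d|%N = 1%N -> diagonal c = diagonal (t n) + d ->
  idem t n * horner_alg (y n.+1) Q * y n.+1 =
    q ^ (diagonal (t n) + d) *: (idem t n * horner_alg (y n.+1) Q) ->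
  idem t n * horner_alg (y n.+1) Q = 0.
Proof.
move=> nN spec gt cn Nright Ndown d1 dd vy.
have [t' [gt' tn tn1 kill]] := corner_last nN spec gt cn Nright Ndown.
apply/kill; apply: (@braid_kill t' n d Q _ _ spec gt' d1) => //.
- by case/subshapeP: cn => l; lia.
- by rewrite tn1 tn.
rewrite tn; apply: mulr_XsubC_eq0; rewrite -mulrA -rmorphM; apply/kill.
by rewrite rmorphM /= mulrA horner_alg_XsubC mulrBr vy -scalerAr mulr1 subrr.
Qed.

Theorem spectralP n : (n <= N)%N -> spectral n.
Proof.
elim/ltn_ind: n => -[_ _|n IHn nN] t gt.
  have c11 : addable (subshape t 0) (1, 1)%N.
    by apply: addableI => // [i j|]; rewrite subshape0.
  rewrite mul1r /add_poly (bigD1_seq (1, 1)%N) ?addables_uniq //=; last exact/mem_addables.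
  by rewrite rmorphM /= horner_alg_XsubC scale1r subrr mul0r.
have spec k : (k < n.+1)%N -> spectral k by move=> kn; apply: IHn => //; lia.
have gt1 := growth_le (leqnSn _) gt; have ab : addable (subshape t n) (t n.+1).
  exact: (gt n.+1 (leqnn n.+1 : (1 <= n.+1 <= n.+1)%N)).
have [quad _ _] := hT; have TT := quad n.+1 nN.
have XX' := comm_JM_pair hT (nN : (1 <= n.+1 <= N)%N).
have X'E : y n.+2 = q *: (T n.+1 * y n.+1 * T n.+1) by rewrite JMS.
have vy Q : idem t n.+1 * horner_alg (y n.+2) Q * y n.+1 =
    qcontent (t n.+1) *: (idem t n.+1 * horner_alg (y n.+2) Q).
  rewrite -mulrA -(comm_horner _ XX') mulrA scalerAl; congr (_ * _).
  by apply: idem_weight => //; lia.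
have vE Q : idem t n.+1 * horner_alg (y n.+2) Q =
    horner_alg (y n.+1) (interp_poly t n.+1) * horner_alg (y n.+2) Q * idem t n.
  rewrite idemS -mulrA; apply: commrM; apply: comm_horner; apply: commr_sym;
    by apply: comm_y_idem; lia.
have eT : GRing.comm (idem t n) (T n.+1) by apply: commr_sym; apply: comm_gen_idem; lia.
have ey : GRing.comm (idem t n) (y n.+1) by apply: commr_sym; apply: comm_y_idem; lia.
have En := spec n (ltnSn n) t gt1.
case tE : (t n.+1) => [i j]; rewrite tE in ab.
have /= /andP[i0 j0] := addable_ge1 ab.
pose R : cell := (i, j.+1); pose B : cell := (i.+1, j).
have diagR : diagonal R = diagonal (i, j) + 1 by rewrite /diagonal /=; lia.
have diagB : diagonal B = diagonal (i, j) + -1 by rewrite /diagonal /=; lia.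
have Nadd c : c \in addables t n -> `|diagonal c - diagonal (i, j)|%N = 1%N -> False.
  move=> /mem_addables aC; have {}aC := aC gt1 (ltnW nN).
  have [->|/(addable_diagonal aC ab)] := eqVneq c (i, j); first by rewrite subrr.
  by move=> h1 h2; rewrite h2 in h1.
pose L := R :: B :: addables t n.
have uL : uniq L.
  rewrite /= inE addables_uniq andbT negb_or; apply/andP; split; last first.
    by apply/negP => /Nadd; apply; rewrite diagB addrC addKr.
  apply/andP; split; first by apply/eqP => -[]; lia.
  by apply/negP => /Nadd; apply; rewrite diagR addrC addKr.
have EL : idem t n.+1 * horner_alg (y n.+2) (\prod_(c <- L) ('X - (qcontent c)%:P)) = 0.
  have phi_comm : GRing.comm (idem t n) (phi (T n.+1) (y n.+1)).
    by apply: commrB; apply: commrM.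
  have kill := affine_kill q0 TT X'E XX' phi_comm En.
  have idemE : idem t n.+1 = horner_alg (y n.+1) (interp_poly t n.+1) * idem t n.
    by rewrite idemS; apply: comm_horner.
  have := phi_phi_weight q0 TT X'E XX' (vy (add_poly t n)).
  have -> : idem t n.+1 * horner_alg (y n.+2) (add_poly t n) *
      (phi (T n.+1) (y n.+1) * phi (T n.+1) (y n.+1)) = 0.
    by rewrite idemE -[_ * idem t n * _]mulrA -mulrA kill mulr0.
  move=> /esym/eqP.
  rewrite scaler_eq0 oppr_eq0 invr_eq0 (negPf q0) /= -mulrA -rmorphM => /eqP.
  rewrite /L 2!big_cons -/(add_poly t n) /qcontent diagR diagB -qexpzD1 -qexpzB1 tE.
  by rewrite mulrC mulrA.
have yD : young (subshape t n.+1) by apply: growth_young gt _.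
have inD : subshape t n.+1 (i, j) by rewrite subshapeS tE eqxx orbT.
have Nij : ~~ subshape t n (i, j) by case: ab.
have notR : ~~ subshape t n.+1 R.
  rewrite subshapeS tE negb_or; apply/andP; split; last by apply/eqP => -[]; lia.
  apply: contra Nij => inR; apply: young_down (growth_young gt1 (leqnn n)) inR _ _; lia.
have notB : ~~ subshape t n.+1 B.
  rewrite subshapeS tE negb_or; apply/andP; split; last by apply/eqP => -[]; lia.
  apply: contra Nij => inB; apply: young_down (growth_young gt1 (leqnn n)) inB _ _; lia.
have badR : ~ addable (subshape t n.+1) R -> (1 < i)%N && ~~ subshape t n.+1 (i.-1, j.+1).
  move=> NaR; apply/negPn/negP => H; apply: NaR; apply: addableI => // i1.
  by move: H; rewrite i1 /= negbK.
have badB : ~ addable (subshape t n.+1) B -> (1 < j)%N && ~~ subshape t n.+1 (i.+1, j.-1).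
  move=> NaB; apply/negPn/negP => H; apply: NaB; apply: addableI => // j1.
  by move: H; rewrite j1 /= negbK.
(* The surviving cells form a duplicate-free part of [addables t n.+1], so their product divides
   [add_poly]. *)
have := horner_filter (good := mem (addables t n.+1)) _ EL.
rewrite /= -big_filter => filt; rewrite /add_poly.
have subL : {subset [seq c <- L | c \in addables t n.+1] <= addables t n.+1}.
  by move=> c; rewrite mem_filter => /andP[].
rewrite (prod_subseq _ (filter_uniq _ uL) (addables_uniq _ _ _) subL) rmorphM /= mulrA.
rewrite filt ?mul0r // {filt subL} => c; rewrite !inE => /or3P[/eqP->|/eqP->|cn] bad Q vy'.
(* [R] fails to be addable only if the cell above it is missing. Then (i - 1, j), on the same
   diagonal as [R], is a corner of the previous shape, and [corner_kill] applies. *)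
- have /andP[i1 Nup] : (1 < i)%N && ~~ subshape t n.+1 (i.-1, j.+1).
    by apply: badR => /(mem_addables _ gt nN); apply/negP.
  apply: (@corner_kill t n.+1 (i.-1, j) 1) => //=.
  + exact: addable_up ab i1.
  + by move: Nup; rewrite subshapeS negb_or => /andP[].
  + by rewrite prednK.
  + by rewrite tE /diagonal /=; lia.
  by rewrite tE -diagR.
- have /andP[j1 Nleft] : (1 < j)%N && ~~ subshape t n.+1 (i.+1, j.-1).
    by apply: badB => /(mem_addables _ gt nN); apply/negP.
  apply: (@corner_kill t n.+1 (i, j.-1) (-1)) => //=.
  + exact: addable_left ab j1.
  + by rewrite prednK.
  + by move: Nleft; rewrite subshapeS negb_or => /andP[].
  + by rewrite tE /diagonal /=; lia.
  by rewrite tE -diagB.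
(* Every other previously addable cell stays addable, so only the last cell itself is left; a
   repetition of its weight is excluded by [weight_distinct]. *)
have cE : c = t n.+1.
  apply/eqP/negPn/negP => cN; move/negP: bad; apply; apply/mem_addables => //.
  have /mem_addables aC := cn; have {}aC := aC gt1 (ltnW nN).
  rewrite tE in cN; apply: eq_addable (addable_setU aC ab cN) => x.
  by rewrite subshapeS tE.
rewrite cE in vy'.
apply: (weight_distinct q0 TT X'E eT En (vE Q) (vy Q) vy' q_neq1 (qcontent_neq0 _) erefl).
have [a a0 pE] := add_polyE gt (ltnW nN).
exists (a *: interp_poly t n.+1); first by rewrite pE scalerAr.
by rewrite hornerZ interp_poly_last // ?mulr1 // ltnW.
Qed.

Lemma idemP t n : (n <= M)%N -> growth t n ->
  forall k, (1 <= k <= n)%N -> idem t n * y k = qcontent (t k) *: idem t n.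
Proof. by move=> nM; apply: idem_weight => // k kn; apply: spectralP; lia. Qed.

End Spectrum.

(** * Hook lengths *)

Section RowsColumns.
Implicit Types (t : nat -> cell).

Definition transpose t k : cell := ((t k).2, (t k).1).

Lemma subshape_transpose t k i j : subshape (transpose t) k (i, j) = subshape t k (j, i).
Proof.
apply/subshapeP/subshapeP => -[l lk tl]; exists l => //.
  by move: tl; rewrite /transpose; case: (t l) => a b /= [-> ->].
by rewrite /transpose tl.
Qed.

Lemma addable_transpose (D D' : cell -> bool) i j : (forall a b, D' (a, b) = D (b, a)) ->
  addable D (i, j) -> addable D' (j, i).
Proof.
move=> DD' [ND yD]; split=> [|a b]; first by rewrite DD'.
rewrite !DD'; have := yD b a; rewrite !xpair_eqE ![(a == _) && _]andbC.
move=> + H => /(_ H)[b0 a0 left up]; split=> //.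
  by move=> /up /orP[->//|]; rewrite ?xpair_eqE andbC => ->; rewrite orbT.
Qed.

Lemma growth_transpose t n : growth t n -> growth (transpose t) n.
Proof.
move=> gt k kn; have := gt k kn; rewrite {2}/transpose; case: (t k) => i j.
by apply: addable_transpose => a b; rewrite subshape_transpose.
Qed.

Definition row_length t k i : nat := \sum_(1 <= l < k.+1) ((t l).1 == i).
Definition col_length t k j : nat := row_length (transpose t) k j.

Lemma row_length0 t i : row_length t 0 i = 0%N.
Proof. by rewrite /row_length big_geq. Qed.

Lemma row_lengthS t k i : row_length t k.+1 i = (row_length t k i + ((t k.+1).1 == i))%N.
Proof. by rewrite /row_length big_nat_recr. Qed.

Lemma col_length0 t i : col_length t 0 i = 0%N.
Proof. exact: row_length0. Qed.

Lemma col_lengthS t k j : col_length t k.+1 j = (col_length t k j + ((t k.+1).2 == j))%N.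
Proof. exact: row_lengthS. Qed.

Lemma subshape_row t k i j : growth t k ->
  subshape t k (i, j) = (1 <= i)%N && (1 <= j <= row_length t k i)%N.
Proof.
elim: k i j => [|k IHk] i j gt; first by rewrite subshape0 row_length0; lia.
have {IHk} sub a b := IHk a b (growth_le (leqnSn _) gt).
have := gt k.+1 (leqnn k.+1 : (1 <= k.+1 <= k.+1)%N); rewrite subshapeS row_lengthS sub /=.
case: (t k.+1) => a b ac; have /= /andP[a0 b0] := addable_ge1 ac.
have [Nab _] := ac; rewrite sub in Nab.
have left : (1 < b)%N -> subshape t k (a, b.-1) := addable_left ac.
rewrite sub in left; rewrite xpair_eqE.
have [ia|ia] := eqVneq a i; last by rewrite addn0 orbF.
by rewrite -ia; lia.
Qed.

Lemma subshape_col t k i j : growth t k ->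
  subshape t k (i, j) = (1 <= j)%N && (1 <= i <= col_length t k j)%N.
Proof. by move=> gt; rewrite -subshape_transpose subshape_row //; apply: growth_transpose. Qed.

Lemma growth_last_row t k : growth t k.+1 -> (t k.+1).2 = (row_length t k (t k.+1).1).+1.
Proof.
move=> gt; have gtk := growth_le (leqnSn _) gt.
have := gt k.+1 (leqnn k.+1 : (1 <= k.+1 <= k.+1)%N).
case: (t k.+1) => a b /= ac; have /= /andP[a0 b0] := addable_ge1 ac.
have [Nab _] := ac; rewrite subshape_row // in Nab.
have left : (1 < b)%N -> subshape t k (a, b.-1) := addable_left ac.
by rewrite subshape_row // in left; lia.
Qed.

Lemma growth_last_col t k : growth t k.+1 -> (t k.+1).1 = (col_length t k (t k.+1).2).+1.
Proof. by move=> gt; rewrite [LHS](growth_last_row (growth_transpose gt)). Qed.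

(** A row above the new cell reaches at least its column, so its end lies on a strictly larger
    diagonal. Thus the denominators of [corner_factor] do not vanish at the new content; columns are
    symmetric. *)
Lemma diagonal_neq_row t k a : growth t k.+1 -> (1 <= a < (t k.+1).1)%N ->
  diagonal (t k.+1) != (row_length t k a)%:Z - a%:Z.
Proof.
move=> gt ai; have gtk := growth_le (leqnSn _) gt.
have lr := growth_last_row gt; have lc := growth_last_col gt.
have := subshape_row a (t k.+1).2 gtk; rewrite subshape_col // /diagonal; lia.
Qed.

Lemma diagonal_neq_col t k j : growth t k.+1 -> (1 <= j < (t k.+1).2)%N ->
  diagonal (t k.+1) != j%:Z - (col_length t k j)%:Z.
Proof.
move=> gt ji; have gtk := growth_le (leqnSn _) gt.
have lr := growth_last_row gt; have lc := growth_last_col gt.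
have := subshape_row (t k.+1).1 j gtk; rewrite subshape_col // /diagonal; lia.
Qed.

End RowsColumns.

Section Products.
Variable K : comPzSemiRingType.

Lemma prod_nat_update (F F' : nat -> K) (x : K) a m n :
  (forall i, i != a -> F' i = F i) -> F' a = F a * x ->
  \prod_(m <= i < n) F' i = \prod_(m <= i < n) F i * (if (m <= a < n)%N then x else 1).
Proof.
move=> FF' Fa; case: ifP => an; last first.
  rewrite mulr1; apply: eq_big_nat => i /= mn; apply: FF'.
  by apply: contraFneq an => <-.
rewrite (bigD1_seq a) ?mem_index_iota ?iota_uniq //= Fa.
rewrite [X in _ = X * _](bigD1_seq a) ?mem_index_iota ?iota_uniq //=.
rewrite (eq_bigr F) => [|i ia]; last exact: FF'.
by rewrite mulrAC.
Qed.

Lemma prod_row t k i (F : nat -> K) : growth t k ->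
  \prod_(1 <= l < k.+1 | (t l).1 == i) F (t l).2 = \prod_(1 <= j < (row_length t k i).+1) F j.
Proof.
elim: k => [|k IHk] gt; first by rewrite row_length0 !big_geq.
rewrite big_mkcond big_nat_recr //= -big_mkcond IHk; last exact: growth_le gt.
rewrite row_lengthS; case: eqP => [ti|_]; last by rewrite mulr1 addn0.
by rewrite addn1 [RHS]big_nat_recr //= (growth_last_row gt) ti.
Qed.

Lemma prod_col t k j (F : nat -> K) : growth t k ->
  \prod_(1 <= l < k.+1 | (t l).2 == j) F (t l).1 = \prod_(1 <= i < (col_length t k j).+1) F i.
Proof. by move=> gt; rewrite -(prod_row _ _ (growth_transpose gt)). Qed.

Lemma prod_cells t k n (F : cell -> K) : growth t k ->
  (forall l, (1 <= l <= k)%N -> ((t l).1 <= n)%N) ->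
  \prod_(1 <= l < k.+1) F (t l) =
  \prod_(1 <= i < n.+1) \prod_(1 <= j < (row_length t k i).+1) F (i, j).
Proof.
elim: k => [|k IHk] gt tn.
  by rewrite big_geq // big1 // => i _; rewrite row_length0 big_geq.
rewrite big_nat_recr //= IHk; [|exact: growth_le gt|by move=> l lk; apply: tn; lia].
have ge1 := addable_ge1 (gt k.+1 (leqnn k.+1 : (1 <= k.+1 <= k.+1)%N)).
rewrite [RHS](@prod_nat_update (fun i => \prod_(1 <= j < (row_length t k i).+1) F (i, j)) _
  (F (t k.+1)) (t k.+1).1); first 1 last.
- by move=> i it; rewrite row_lengthS eq_sym (negPf it) addn0.
- rewrite row_lengthS eqxx addn1 big_nat_recr //=; congr (_ * F _).
  by rewrite -(growth_last_row gt); case: (t k.+1).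
case: ifP => // /negP[]; have := tn k.+1 (leqnn k.+1 : (1 <= k.+1 <= k.+1)%N); lia.
Qed.

End Products.

(** * The scalar factor as a ratio of hook products *)

Section Hooks.
Variables (K : fieldType) (q : K).
Hypotheses (q0 : q != 0) (q_generic : forall z : int, q ^ z = 1 -> z = 0).
Implicit Types (t : nat -> cell).
Local Notation qcontent := (qcontent q).

(* Ratio by which the resolvent normalisation loses its zero at the content of
   the cell of [k.+1]. *)
Definition corner_factor t k (u : K) : K :=
  \prod_(1 <= a < (t k.+1).1)
     ((u - q ^ ((row_length t k a)%:Z - a%:Z + 1)) / (u - q ^ ((row_length t k a)%:Z - a%:Z))) *
  \prod_(1 <= j < (t k.+1).2)
     ((u - q ^ (j%:Z - (col_length t k j)%:Z - 1)) / (u - q ^ (j%:Z - (col_length t k j)%:Z))).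

Lemma fusion_factorE t k u : growth t k.+1 -> (forall z : int, u != q ^ z) ->
  (u - 1) * \prod_(1 <= l < k.+1)
     ((u - q * qcontent (t l)) * (u - q^-1 * qcontent (t l)) / (u - qcontent (t l)) ^+ 2) =
  (u - qcontent (t k.+1)) * corner_factor t k u.
Proof.
move=> gt uq; rewrite /corner_factor.
have un z : u - q ^ z != 0 by rewrite subr_eq0.
have last_row := growth_last_row gt; have last_col := growth_last_col gt.
have ac := gt k.+1 (leqnn k.+1 : (1 <= k.+1 <= k.+1)%N).
have gtk := growth_le (leqnSn _) gt.
have [notin _] := ac; rewrite /= in notin.
set c := qcontent (t k.+1); set i0 := (t k.+1).1 in last_row last_col *.
set j0 := (t k.+1).2 in last_row last_col *.
pose rho (z : int) := (u - q ^ (z + 1)) / (u - q ^ z).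
have rho0 z : rho z != 0 by rewrite mulf_neq0 ?invr_eq0.
(* A cell on diagonal d contributes rho d / rho (d - 1). Cells in rows up to [i0] telescope along
   their row; lower ones lie in columns before [j0] and telescope down their column from row [i0],
   whence the [maxn]. The leading constant makes [Z 0] equal to u - 1. *)
pose Z l := (u - q ^ (diagonal (t k.+1) - 1)) *
  \prod_(1 <= a < i0.+1) rho ((row_length t l a)%:Z - a%:Z) *
  \prod_(1 <= j < j0) (rho (j%:Z - (maxn (col_length t l j) i0)%:Z - 1))^-1.
have ZP l : (l <= k)%N -> (u - 1) * \prod_(1 <= l' < l.+1)
     ((u - q * qcontent (t l')) * (u - q^-1 * qcontent (t l')) / (u - qcontent (t l')) ^+ 2) = Z l.
  elim: l => [_|l IHl lt_lk].
    rewrite big_geq // mulr1 /Z.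
    have rows n : \prod_(1 <= a < n.+1) rho ((row_length t 0 a)%:Z - a%:Z) =
        (u - 1) / (u - q ^ (- n%:Z)).
      elim: n => [|n IHn]; first by rewrite big_geq // oppr0 expr0z mulfV // -(expr0z q).
      have rhoE : rho (0%N%:Z - n.+1%:Z) = (u - q ^ (- n%:Z)) / (u - q ^ (- n.+1%:Z)).
        by rewrite /rho; congr ((u - q ^ _) / (u - q ^ _)); lia.
      by rewrite big_nat_recr //= IHn row_length0 rhoE mulrA divfK.
    have cols n : \prod_(1 <= j < n.+1) (rho (j%:Z - (maxn (col_length t 0 j) i0)%:Z - 1))^-1 =
        (u - q ^ (- i0%:Z)) / (u - q ^ (n%:Z - i0%:Z)).
      elim: n => [|n IHn]; first by rewrite big_geq // sub0r mulfV.
      have rhoE : rho (n.+1%:Z - i0%:Z - 1) =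
          (u - q ^ (n.+1%:Z - i0%:Z)) / (u - q ^ (n%:Z - i0%:Z)).
        by rewrite /rho; congr ((u - q ^ _) / (u - q ^ _)); lia.
      by rewrite big_nat_recr //= IHn col_length0 max0n rhoE invf_div mulrA divfK.
    have [n j0E] : exists n, j0 = n.+1 by eexists; exact: last_row.
    have dE : n%:Z - i0%:Z = diagonal (t k.+1) - 1 by rewrite /diagonal -/i0 -/j0 j0E; lia.
    by rewrite rows j0E cols dE; field; rewrite !un.
  rewrite big_nat_recr //= mulrA IHl ?(ltnW lt_lk) // {IHl}.
  have gtl : growth t l.+1 by apply: growth_le gt; lia.
  have l_row := growth_last_row gtl; have l_col := growth_last_col gtl.
  have tin : subshape t k (t l.+1) by apply/subshapeP; exists l.+1.
  have := row_lengthS t l; have := col_lengthS t l.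
  have phiE : (u - q * qcontent (t l.+1)) * (u - q^-1 * qcontent (t l.+1)) /
      (u - qcontent (t l.+1)) ^+ 2 = rho (diagonal (t l.+1)) / rho (diagonal (t l.+1) - 1).
    rewrite /rho /qcontent qexpzD1 // qexpzB1 // subrK.
    by field; rewrite !un.
  rewrite phiE {phiE}; move: tin l_row l_col; rewrite /Z /diagonal.
  case: (t l.+1) => a b /= tin l_row l_col colS rowS.
  have [le_ai|lt_ia] := leqP a i0.
    rewrite [in RHS](@prod_nat_update _ (fun a => rho ((row_length t l a)%:Z - a%:Z)) _
      (rho (b%:Z - a%:Z) / rho (b%:Z - a%:Z - 1)) a).
    - have -> : (1 <= a < i0.+1)%N by lia.
      rewrite [_ * (_ * (_ / _))]mulrA [RHS]mulrAC; congr (_ * _ * _); apply: eq_big_nat => j j1.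
      by rewrite colS; case: eqP => [bj|_]; [rewrite -bj; congr (rho _)^-1; lia | rewrite addn0].
    - by move=> i /negPf ia; rewrite rowS eq_sym ia addn0.
    have e1 : (row_length t l a)%:Z - a%:Z = b%:Z - a%:Z - 1 by lia.
    have e2 : (row_length t l a + (a == a))%N%:Z - a%:Z = b%:Z - a%:Z by rewrite eqxx; lia.
    by rewrite rowS e1 e2 mulrC divfK.
  rewrite [X in _ = _ * X](@prod_nat_update _
    (fun j => (rho (j%:Z - (maxn (col_length t l j) i0)%:Z - 1))^-1) _
    (rho (b%:Z - a%:Z) / rho (b%:Z - a%:Z - 1)) b).
  - have lt_bj : (b < j0)%N.
      rewrite ltnNge; apply: contra notin => le_jb.
      have -> : t k.+1 = (i0, j0) by rewrite /i0 /j0; case: (t k.+1).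
      by apply: young_down (growth_young gtk (leqnn k)) tin _ _; lia.
    have -> : (1 <= b < j0)%N by lia.
    rewrite [RHS]mulrA; congr (_ * _ * _ * _); apply: eq_big_nat => i i1.
    congr (rho _).
    by rewrite rowS gtn_eqF ?addn0 //; lia.
  - by move=> j /negPf jb; rewrite colS eq_sym jb addn0.
  have e1 : b%:Z - (maxn (col_length t l b) i0)%:Z - 1 = b%:Z - a%:Z by lia.
  have e2 : b%:Z - (maxn (col_length t l b + (b == b)) i0)%:Z - 1 = b%:Z - a%:Z - 1.
    by rewrite eqxx; lia.
  by rewrite colS e1 e2 mulrA mulVf ?mul1r.
(* Row [i0] ends just before the new cell: its factor supplies the zero u - c and cancels the
   leading constant. *)
rewrite ZP // /Z big_nat_recr /=; last lia.
have e1 : (row_length t k i0)%:Z - i0%:Z = diagonal (t k.+1) - 1.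
  by rewrite /diagonal -/i0 -/j0; lia.
have -> : \prod_(1 <= j < j0) (rho (j%:Z - (maxn (col_length t k j) i0)%:Z - 1))^-1 =
    \prod_(1 <= j < j0) ((u - q ^ (j%:Z - (col_length t k j)%:Z - 1)) /
                         (u - q ^ (j%:Z - (col_length t k j)%:Z))).
  apply: eq_big_nat => j jj0.
  have := subshape_row i0 j gtk; rewrite subshape_col // => e2.
  have -> : maxn (col_length t k j) i0 = col_length t k j by lia.
  by rewrite /rho invf_div subrK.
rewrite e1 {2}/rho subrK -/(qcontent _) -/c.
move: (\prod_(_ <= _ < _) _) (\prod_(_ <= _ < _) _) => P1 P2.
by field; rewrite un.
Qed.

Definition hook_at t k (c : cell) : nat :=
  (row_length t k c.1 + col_length t k c.2 + 1 - (c.1 + c.2))%N.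

Definition hook_prod t k : K := \prod_(1 <= l < k.+1) (1 - q ^+ hook_at t k (t l)).

Lemma qexpn_neq1 n : (0 < n)%N -> 1 - q ^+ n != 0.
Proof.
by rewrite subr_eq0 eq_sym => n0; apply/eqP => /(q_generic (z := n)); lia.
Qed.

Lemma hook_at_gt0 t k l : growth t k -> (1 <= l <= k)%N -> (0 < hook_at t k (t l))%N.
Proof.
move=> gt lk; have tin : subshape t k (t l) by apply/subshapeP; exists l.
rewrite /hook_at; case: (t l) tin => i j /= tin.
by have := tin; rewrite subshape_row // => h1; move: tin; rewrite subshape_col // => h2; lia.
Qed.

Lemma hook_prod_neq0 t k : growth t k -> hook_prod t k != 0.
Proof.
move=> gt; rewrite /hook_prod big_seq; apply: (big_ind (fun x => x != 0)).
- exact: oner_neq0.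
- by move=> x y; apply: mulf_neq0.
by move=> l; rewrite mem_index_iota => lk; apply: qexpn_neq1; apply: hook_at_gt0.
Qed.

(** The new cell has hook 1 and lengthens by one the hooks in its row and column. Those ratios are
    the factors of [corner_factor] at the new content, up to one q for each cell to its left. *)
Lemma hook_prodS t k : growth t k.+1 ->
  hook_prod t k.+1 = (1 - q) * q ^+ (t k.+1).2.-1 *
    corner_factor t k (qcontent (t k.+1)) * hook_prod t k.
Proof.
move=> gt; have gtk := growth_le (leqnSn _) gt.
have last_row := growth_last_row gt; have last_col := growth_last_col gt.
have ac := gt k.+1 (leqnn k.+1 : (1 <= k.+1 <= k.+1)%N).
have [notin _] := ac; rewrite /= in notin.
have rowS := row_lengthS t k; have colS := col_lengthS t k.
rewrite /corner_factor /qcontent /diagonal; move: last_row last_col notin rowS colS.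
case tE : (t k.+1) => [i0 j0] /= last_row last_col notin rowS colS.
pose X (z : int) : K := (1 - q ^ (z + 1)) / (1 - q ^ z).
pose nrow j : int := j0%:Z - j%:Z + (col_length t k j)%:Z - i0%:Z.
pose ncol i : int := (row_length t k i)%:Z - i%:Z + i0%:Z - j0%:Z.
have XS n : (0 < n)%N -> 1 - q ^+ n.+1 = (1 - q ^+ n) * X n.
  move=> n0; rewrite /X (_ : n%:Z + 1 = n.+1%:Z) -?exprnP; last lia.
  by rewrite mulrC divfK // qexpn_neq1.
have step : \prod_(1 <= l < k.+1) (1 - q ^+ hook_at t k.+1 (t l)) = hook_prod t k *
   (\prod_(1 <= l < k.+1 | (t l).1 == i0) X (nrow (t l).2) *
    \prod_(1 <= l < k.+1 | (t l).2 == j0) X (ncol (t l).1)).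
  rewrite [X in _ * (X * _)]big_mkcond [X in _ * (_ * X)]big_mkcond -!big_split.
  apply: eq_big_nat => l lk /=.
  have hpos := hook_at_gt0 gtk lk; have tin : subshape t k (t l) by apply/subshapeP; exists l.
  have tin' := tin; move: hpos tin tin'; rewrite /hook_at /nrow /ncol.
  case: (t l) => i j /= hpos tin; rewrite subshape_row // => hrow.
  have hcol := tin; rewrite subshape_col // in hcol; rewrite rowS colS.
  have [ii|ii] := eqVneq i i0; have [jj|jj] := eqVneq j j0.
  - by rewrite ii jj (negPf notin) in tin.
  - rewrite ii in hpos hrow hcol *; rewrite /= mulr1.
    have -> : (row_length t k i0 + true + (col_length t k j + false) + 1 - (i0 + j) =
      (row_length t k i0 + col_length t k j + 1 - (i0 + j)).+1)%N by lia.
    rewrite XS //; congr (_ * X _); lia.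
  - rewrite jj in hpos hrow hcol *; rewrite /= mul1r.
    have -> : (row_length t k i + false + (col_length t k j0 + true) + 1 - (i + j0) =
      (row_length t k i + col_length t k j0 + 1 - (i + j0)).+1)%N by lia.
    rewrite XS //; congr (_ * X _); lia.
  - by rewrite /= !addn0 !mulr1.
rewrite /hook_prod big_nat_recr //= step tE.
have -> : hook_at t k.+1 (i0, j0) = 1%N.
  by rewrite /hook_at /= rowS colS !eqxx; lia.
rewrite (prod_row i0 (fun j => X (nrow j)) gtk) (prod_col j0 (fun i => X (ncol i)) gtk).
rewrite -last_row -last_col -/(hook_prod t k).
have -> : \prod_(1 <= i < i0) X (ncol i) = \prod_(1 <= a < i0)
    ((q ^ (j0%:Z - i0%:Z) - q ^ ((row_length t k a)%:Z - a%:Z + 1)) /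
     (q ^ (j0%:Z - i0%:Z) - q ^ ((row_length t k a)%:Z - a%:Z))).
  apply: eq_bigr => a _; set d := j0%:Z - i0%:Z.
  have e1 : (row_length t k a)%:Z - a%:Z + 1 = d + (ncol a + 1) by rewrite /ncol /d; lia.
  have e0 : (row_length t k a)%:Z - a%:Z = d + ncol a by rewrite /ncol /d; lia.
  have fac w : q ^ d - q ^ (d + w) = q ^ d * (1 - q ^ w) by rewrite expfzDr // mulrBr mulr1.
  by rewrite e1 e0 !fac -mulf_div divff ?mul1r // expfz_neq0.
have -> : \prod_(1 <= j < j0) X (nrow j) = q ^+ j0.-1 * \prod_(1 <= j < j0)
    ((q ^ (j0%:Z - i0%:Z) - q ^ (j%:Z - (col_length t k j)%:Z - 1)) /
     (q ^ (j0%:Z - i0%:Z) - q ^ (j%:Z - (col_length t k j)%:Z))).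
  rewrite -subn1 -prodr_const_nat -big_split /=; apply: eq_bigr => j _.
  set e := j%:Z - _; have -> : j0%:Z - i0%:Z = e + nrow j by rewrite /nrow /e; lia.
  rewrite /X -(qexpzB1 q0 e) -(qexpzD1 q0 (nrow j)) expfzDr //.
  have a0 : q ^ e != 0 by apply: expfz_neq0.
  move: (q ^ e) (q ^ nrow j) a0 => a b a0.
  have -> : a * b - q^-1 * a = - (q^-1 * a) * (1 - q * b) by field.
  have -> : a * b - a = - a * (1 - b) by ring.
  have aq : q * (- (q^-1 * a) / - a) = 1 by field; rewrite q0 oppr_eq0 a0.
  by rewrite -mulf_div [q * (_ / _ * _)]mulrA aq mul1r.
by rewrite expr1; ring.
Qed.

(** The normalisation for the shape of the first [k] entries; [n] bounds the number of rows and
    stays [size lam] at all stages. *)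
Definition fcoef t k n s : K :=
  q ^+ (\sum_(1 <= i < n.+1) 'C(row_length t k i, 2)) * s ^- 'C(k, 2) * (1 - q) ^+ k *
  (hook_prod t k)^-1.

Lemma fcoef_neq0 t k n s : s != 0 -> growth t k -> fcoef t k n s != 0.
Proof.
move=> s0 gt; rewrite !mulf_neq0 ?invr_eq0 ?expf_neq0 ?hook_prod_neq0 //.
by have := @qexpn_neq1 1; rewrite expr1; apply.
Qed.

(** The binomial of the growing row increases by the column index minus one, which absorbs the power
    of q in [hook_prodS] and accounts for b(lambda'); likewise C(k, 2) increases by k. *)
Lemma fcoefS t k n s : s != 0 -> growth t k.+1 -> ((t k.+1).1 <= n)%N ->
  fcoef t k n s = fcoef t k.+1 n s * (s ^+ k * corner_factor t k (qcontent (t k.+1))).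
Proof.
move=> s0 gt le_n; rewrite /fcoef hook_prodS //.
have gtk := growth_le (leqnSn _) gt.
have := addable_ge1 (gt k.+1 (leqnn k.+1 : (1 <= k.+1 <= k.+1)%N)) => /andP[i0 j0].
have rowS := row_lengthS t k; have last_row := growth_last_row gt.
rewrite -[in RHS]prodrXr (@prod_nat_update _
  (fun i => q ^+ 'C(row_length t k i, 2)) _ (q ^+ (t k.+1).2.-1) (t k.+1).1); first 1 last.
- by move=> i ia; rewrite rowS eq_sym (negPf ia) addn0.
- by rewrite rowS eqxx addn1 binS bin1 exprD last_row.
rewrite prodrXr ltnS i0 le_n /= binS bin1 exprD exprS.
have hk := hook_prod_neq0 gtk; have q1 := qexpn_neq1 (ltn0Sn 0); rewrite expr1 in q1.
have cf : corner_factor t k (qcontent (t k.+1)) != 0.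
  apply: contraNneq (hook_prod_neq0 gt) => cf.
  by rewrite hook_prodS // cf mulr0 mul0r.
have pq : q ^+ (t k.+1).2.-1 != 0 by apply: expf_neq0.
have ps : s ^+ k != 0 by apply: expf_neq0.
have ps2 : s ^+ 'C(k, 2) != 0 by apply: expf_neq0.
by field; rewrite pq ps ps2 cf hk q1.
Qed.

End Hooks.

Lemma fmorph_fcoef (K L : fieldType) (h : {rmorphism K -> L}) q t k n s :
  h (fcoef q t k n s) = fcoef (h q) t k n (h s).
Proof.
rewrite /fcoef !rmorphM /= !fmorphV !rmorphXn rmorphB rmorph1 /hook_prod rmorph_prod.
congr (_ * _^-1); apply: eq_bigr => l _.
by rewrite rmorphB rmorph1 rmorphXn.
Qed.

(** * The fusion procedure *)

Lemma conjpP lam i j : sorted geq lam -> (1 <= j)%N ->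
  (i < conjp lam j)%N = (j <= nth 0%N lam i)%N.
Proof.
elim: lam i => [|x lam IHlam] i /= srt j1; first by rewrite nth_nil; lia.
have sl : sorted geq lam := path_sorted srt.
have [le_jx|lt_xj] := leqP j x; first by case: i => //= i; rewrite add1n ltnS IHlam.
have /allP le_x : all (geq x) lam by apply: order_path_min srt => a b c /= h1 h2; lia.
rewrite add0n -/(conjp lam j) (_ : conjp lam j = 0%N); last first.
  apply/eqP; rewrite -leqn0 leqNgt -has_count; apply/hasPn => z /le_x /=; lia.
case: i => [|i] /=; first lia.
have [lt_i|le_i] := ltnP i (size lam); last by rewrite nth_default //; lia.
by have /le_x /= := mem_nth 0%N lt_i; lia.
Qed.

Section StandardTableau.
Variables (m : nat) (lam : seq nat) (t : nat -> cell).
Hypotheses (part : is_partition m lam) (std : standard_tableau m lam t).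

Lemma in_diag_left i j : in_diag lam (i, j) -> (1 < j)%N -> in_diag lam (i, j.-1).
Proof. rewrite /in_diag /=; lia. Qed.

Lemma in_diag_up i j : in_diag lam (i, j) -> (1 < i)%N -> in_diag lam (i.-1, j).
Proof.
case: part => srt _ _; rewrite /in_diag /= => /andP[/andP[i0 le_i] /andP[j0]] le_j i1.
rewrite -conjpP // in le_j; rewrite j0 -conjpP //; lia.
Qed.

Lemma subshape_std c : subshape t m c = in_diag lam c.
Proof.
case: std => inD _ onto _ _; apply/subshapeP/idP => [[k km <-]|]; first exact: inD.
by case/onto=> k km <-; exists k.
Qed.

Lemma std_growth : growth t m.
Proof.
case: std => inD inj onto rows cols k km; split.
  by apply/subshapeP => -[l lk] /inj; lia.
have Dk x : subshape t k.-1 x || (x == t k) = subshape t k x.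
  by case: k km => // k _; rewrite subshapeS.
move=> i j; rewrite !Dk => /subshapeP[l lk tl].
have lm : (1 <= l <= m)%N by lia.
have := inD l lm; rewrite tl => ij; have /andP[/andP[i0 _] /andP[j0 _]] := ij.
split=> // [i1|j1].
  have [l' l'm tl'] := onto _ (in_diag_up ij i1); apply/subshapeP; exists l' => //.
  by have := cols l' l l'm lm; rewrite tl tl' /=; move/(_ erefl); lia.
have [l' l'm tl'] := onto _ (in_diag_left ij j1); apply/subshapeP; exists l' => //.
by have := rows l' l l'm lm; rewrite tl tl' /=; move/(_ erefl); lia.
Qed.

Lemma std_row_length i : (1 <= i <= size lam)%N -> row_length t m i = nth 0%N lam i.-1.
Proof.
move=> ilam; have H j : (1 <= j)%N -> (j <= row_length t m i)%N = (j <= nth 0%N lam i.-1)%N.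
  move=> j1; have := subshape_row i j std_growth.
  by rewrite subshape_std /in_diag /= j1 ilam; case/andP: ilam => -> _ /= ->.
apply/eqP; rewrite eqn_leq; apply/andP; split.
  by case: (row_length t m i) (H (row_length t m i)) => // n <-.
by case: (nth _ _ _) (H (nth 0%N lam i.-1)) => // n ->.
Qed.

Lemma std_col_length j : (1 <= j)%N -> col_length t m j = conjp lam j.
Proof.
move=> j1; case: part => srt _ _.
have H i : (1 <= i)%N -> (i <= col_length t m j)%N = (i <= conjp lam j)%N.
  move=> i1; have := subshape_col i j std_growth; rewrite subshape_std /in_diag /= j1 i1 /= => <-.
  have := conjpP i.-1 srt j1; rewrite prednK // => <-.
  by have : (conjp lam j <= size lam)%N := count_size _ _; lia.
apply/eqP; rewrite eqn_leq; apply/andP; split.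
  by case: (col_length t m j) (H (col_length t m j)) => // n <-.
by case: (conjp _ _) (H (conjp lam j)) => // n ->.
Qed.

Lemma std_row_bound k : (1 <= k <= m)%N -> ((t k).1 <= size lam)%N.
Proof. by case: std => inD _ _ _ _ /inD; rewrite /in_diag => /andP[/andP[_]]. Qed.

Lemma fnormE r s : fnorm r s m lam = fcoef (s / r) t m (size lam) s.
Proof.
rewrite /fnorm /fcoef; congr (_ ^+ _ * _ * _ * _).
  rewrite /bconj sumnE big_map (big_nth 0%N) big_add1 /=; apply: eq_big_nat => i ilam.
  by rewrite std_row_length.
rewrite /hook_prod (prod_cells (fun c => 1 - (s / r) ^+ hook_at t m c) std_growth std_row_bound).
rewrite -prodfV; apply: eq_big_nat => i ilam; rewrite -prodfV std_row_length //.
apply: eq_big_nat => j jlam; rewrite /hook_at /hook /= std_row_length // std_col_length //.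
by case/andP: jlam.
Qed.

End StandardTableau.

Section FusionProcedure.
Variables (r s : CC) (m : nat) (lam : seq nat) (t : nat -> cell).
Variables (A : unitAlgType (RF m)) (T : nat -> A).
Hypotheses (r0 : r != 0) (s0 : s != 0).
Hypothesis root_of_unity : forall n : nat, (0 < n)%N -> (r / s) ^+ n != 1.
Hypotheses (m0 : (1 <= m)%N) (part : is_partition m lam) (std : standard_tableau m lam t).
Hypothesis hecke_T : hecke_rels T r s.

Local Notation iota := (emb m).
Local Notation K := (RF m).
Local Notation q := (iota (s / r)).
Local Notation y := (JM q T).
Local Notation sg := (fun k => content r s (t k.+1)).
Local Notation idem := (idem q m.-1 T).
Local Notation sigma k := (qcontent q (t k)).
Local Notation u n := (var m n).
Local Notation pea := (pea T sg).
Local Notation S := (iota s).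

Let gt : growth t m. Proof. exact: std_growth part std. Qed.

Lemma generic_C (z : int) : (s / r) ^ z = 1 -> z = 0.
Proof.
have qrs : (s / r)^-1 = r / s by rewrite invf_div.
case: z => [[//|n]|n].
  rewrite -exprnP => e; have /eqP[] := root_of_unity (ltn0Sn n).
  by rewrite -qrs exprVn e invr1.
by rewrite NegzE -exprnN -exprVn qrs => /eqP; rewrite (negPf (root_of_unity (ltn0Sn n))).
Qed.

Let qC0 : s / r != 0. Proof. by rewrite mulf_neq0 ?invr_eq0. Qed.
Let q0 : q != 0. Proof. by rewrite fmorph_eq0. Qed.
Let S0 : S != 0. Proof. by rewrite fmorph_eq0. Qed.

Let q_generic (z : int) : q ^ z = 1 -> z = 0.
Proof. by rewrite -fmorphXz -(rmorph1 iota) => /fmorph_inj/generic_C. Qed.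

Lemma iota_content c : iota (content r s c) = qcontent q c.
Proof. by rewrite fmorphXz. Qed.

Lemma var_generic n (z : int) : (n < m)%N -> u n != q ^ z.
Proof. by move=> nm; rewrite -fmorphXz var_neq_emb. Qed.

Let hT : hecke q m.-1 T.
Proof.
case: hecke_T => braid far quad; split=> [i im|i im|i j im jm ij]; last exact: far.
  have := quad i im; rewrite mulrBl mul1r mulrDr -scalerAr mulr1 => /eqP.
  rewrite subr_eq add0r => /eqP e.
  have {e} : T i * T i = T i + (iota (r / s))%:A - iota (r / s) *: T i.
    by rewrite -e addrK.
  by move=> ->; rewrite -fmorphV invf_div scalerBl scale1r addrAC.
by apply: braid; lia.
Qed.

Lemma jmE k : jm T r s k = y k.
Proof. by elim: k => // -[//|k] IHk; rewrite [RHS]JMS // -IHk. Qed.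

Lemma EfactorE k : (1 <= k <= m)%N ->
  Efactor T r s t k = horner_alg (y k) (interp_poly q m.-1 t k).
Proof.
move=> km; rewrite /Efactor /interp_poly /addables prednK //.
rewrite rmorph_prod big_filter_cond [RHS]big_mkcond /= big_allpairs_dep /=.
apply: eq_bigr => i _; rewrite [LHS]big_mkcond; apply: eq_bigr => j _.
case: ifP => // _.
by rewrite horner_algZ horner_alg_XsubC jmE fmorphV rmorphB /= !iota_content.
Qed.

Lemma EidemE k : (k <= m)%N -> Eidem T r s t k = idem t k.
Proof.
elim: k => // k IHk km; rewrite idemS -IHk ?(ltnW km) // -EfactorE; last lia.
(* Only [idem] has a factor for entry 1. It is an empty product, (1, 1) being the sole addable cell
   of the empty shape. *)
case: k IHk km => [_ km|//]; rewrite /= mul1r EfactorE // /interp_poly big_seq_cond.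
rewrite big1 ?rmorph1 // => c /andP[c0 ct].
have g0 : growth t 0 by apply: growth_le gt.
have /(mem_addables _ g0 (leq0n m.-1)) aC := c0.
have a1 : addable (subshape t 0) (t 1%N) := @gt 1%N km.
have := addable_antichain aC a1 ct; have := addable_box g0 aC; have := addable_box g0 a1.
have := addable_ge1 aC; have := addable_ge1 a1; lia.
Qed.

Lemma TwE k : Tw T k = longest T k.
Proof.
case: k => [|k]; first by rewrite /Tw big_geq.
elim: k => [|k IHk]; first by rewrite /Tw big_geq //= /up_prod big_geq // mulr1.
by rewrite longestS -IHk /Tw big_nat_recl.
Qed.

Lemma gen_inverse i : (1 <= i <= m.-1)%N ->
  T i \is a GRing.unit /\ (T i)^-1 = q *: T i + (1 - q)%:A.
Proof.
move=> im; have [quad _ _] := hT; have TT := quad i im.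
have [l1 l2] := quadratic_inverse q0 TT.
have uT : T i \is a GRing.unit by apply/unitrP; exists (q *: T i + (1 - q)%:A).
by split=> //; rewrite -[RHS](mulKr uT) l1 mulr1.
Qed.

(** Elements free of the variables, together with their inverses. The inverse [(Tw m)^-1] in [Psi]
    has to be expanded over words too, which is possible because [(T i)^-1] is a combination of
    [T i] and 1. *)
Definition const_unit X :=
  [/\ X \is a GRing.unit, forall k, pea k X X & forall k, pea k X^-1 X^-1].

Lemma const_unitM X Y : const_unit X -> const_unit Y -> const_unit (X * Y).
Proof.
move=> [uX cX iX] [uY cY iY]; split=> [|k|k].
- by rewrite unitrMl.
- exact: peaM.
by rewrite invrM //; apply: peaM.
Qed.

Lemma const_unit1 : const_unit 1.
Proof. by split=> [|k|k]; rewrite ?invr1 ?unitr1 //; apply: pea1. Qed.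

Lemma const_unit_gen i : (1 <= i <= m.-1)%N -> const_unit (T i).
Proof.
move=> im; have [uT iT] := gen_inverse im; split=> // k; first exact: pea_gen.
rewrite iT; apply: peaD; first by apply: peaZ; [apply: pe_emb | apply: pea_gen].
by apply: pea_alg; rewrite -(rmorph1 iota) -rmorphB; apply: pe_emb.
Qed.

Lemma const_unit_prod k (f : nat -> nat) :
  (forall i, (1 <= i < k)%N -> (1 <= f i <= m.-1)%N) ->
  const_unit (\prod_(1 <= i < k) T (f i)).
Proof.
move=> fm; rewrite big_seq; apply: (big_ind const_unit).
- exact: const_unit1.
- exact: const_unitM.
by move=> i; rewrite mem_index_iota => /fm; apply: const_unit_gen.
Qed.

Lemma const_unit_longest k : (k <= m)%N -> const_unit (longest T k).
Proof.
elim: k => [|k IHk] km; first exact: const_unit1.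
rewrite longestS; apply: const_unitM; last exact/IHk/ltnW.
by apply: (@const_unit_prod _ id) => i ik; lia.
Qed.

Lemma const_unit_down k : (k <= m)%N -> const_unit (down_prod T k).
Proof. by move=> km; apply: (@const_unit_prod _ (fun i => k - i)%N) => i ik; lia. Qed.

Lemma pea_JM k n : (n <= m)%N -> pea k (y n) (y n).
Proof.
elim: n => [|[|n] IHn] nm; try exact: pea1.
have pT : pea k (T n.+1) (T n.+1) by apply: pea_gen; lia.
rewrite JMS //; apply: peaZ; first exact: pe_emb.
by apply: peaM => //; apply: peaM => //; apply/IHn/ltnW.
Qed.

Lemma pea_idem k n : (n <= m)%N -> pea k (idem t n) (idem t n).
Proof.
elim: n => [|n IHn] nm; first exact: pea1.
rewrite idemS; apply: peaM; first exact/IHn/ltnW.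
rewrite /interp_poly rmorph_prod; apply: pea_prod => c _ _ /=.
rewrite horner_algZ horner_alg_XsubC -!iota_content -rmorphB -fmorphV.
apply: peaZ; first exact: pe_emb.
by apply: peaB; [apply: pea_JM | apply/pea_alg/pe_emb].
Qed.

Lemma TbE i x z : Tb T r s i x z = S *: (T i + ((1 - q^-1) / (z / x - 1))%:A).
Proof.
rewrite /Tb scalerDr scalerA mulrA; congr (_ + (_ / _)%:A).
by rewrite -fmorphV invf_div mulrBr mulr1 -rmorphM mulrCA mulfV // mulr1.
Qed.

(** The leading [longest T n] undoes the inverse ending [Psi_upto n], and the two trailing inverses
    form that of [longest T n.+1]. Here [u n] is the variable u_(n+1), and [x j] is u_j or its
    value. *)
Definition Phi n (x : nat -> K) : A :=
  longest T n * (\prod_(1 <= j < n.+1) Tb T r s (n - j + 1) (x j) (u n))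
   * (down_prod T n.+1)^-1 * (longest T n)^-1.

Definition Psi_upto n : A :=
  (\prod_(1 <= k < n) \prod_(1 <= j < k.+1) Tb T r s (k - j + 1) (u j.-1) (u k))
   * (longest T n)^-1.

Lemma Psi_uptoS n : (n < m)%N -> Psi_upto n.+1 = Psi_upto n * Phi n (fun j => u j.-1).
Proof.
move=> nm; rewrite /Phi /Psi_upto.
have [ul _ _] := const_unit_longest (ltnW nm); have [ud _ _] := const_unit_down nm.
rewrite (longestSr hT); last lia.
rewrite invrM // !mulrA divrK //.
case: n nm {ul ud} => [|n] nm; last by rewrite big_nat_recr.
by rewrite !big_geq // mulr1 /= invr1 !mul1r.
Qed.

Lemma sigma_neq0 k : sigma k != 0. Proof. exact: qcontent_neq0. Qed.

Lemma pea_Phi n : (n < m)%N -> pea n (Phi n (fun j => u j.-1)) (Phi n (fun j => sigma j)).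
Proof.
move=> nm; have [_ cl il] := const_unit_longest (ltnW nm).
have [_ _ id] := const_unit_down nm.
rewrite /Phi; do 2![apply: peaM => //]; apply: peaM => //.
apply: pea_prod => j; rewrite mem_index_iota => jn _.
have pT : pea n (T (n - j + 1)) (T (n - j + 1)) by apply: pea_gen; lia.
rewrite /Tb; apply: peaD; first by apply: peaZ => //; apply: pe_emb.
have uj : pe n (u j.-1) sg (sigma j).
  have := @pe_var_lt n m j.-1 sg; rewrite /= iota_content prednK; last lia.
  by apply; lia.
apply: pea_alg; apply: pe_div.
- rewrite subr_eq0 -(divff (sigma_neq0 j)).
  by rewrite (inj_eq (mulIf _)) ?invr_eq0 ?sigma_neq0 // var_generic.
- by apply: peB; apply: pe_emb.
apply: peB; last exact: pe1.
by apply: pe_div => //; [apply: sigma_neq0 | apply: pe_var_ge].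
Qed.

Lemma pe_corner_factor n : (n < m)%N ->
  pe n.+1 (corner_factor q t n (u n)) sg (corner_factor q t n (sigma n.+1)).
Proof.
move=> nm; have gn : growth t n.+1 := growth_le nm gt.
have pu : pe n.+1 (u n) sg (sigma n.+1) by rewrite -iota_content; apply: pe_var_lt.
have pq (z : int) : pe n.+1 (q ^ z) sg (q ^ z) by rewrite -fmorphXz; apply: pe_emb.
apply: peM; apply: pe_prod => i; rewrite mem_index_iota => il.
  apply: pe_div; [|exact: peB|exact: peB].
  by rewrite subr_eq0 qexpz_eq // diagonal_neq_row.
apply: pe_div; [|exact: peB|exact: peB].
by rewrite subr_eq0 qexpz_eq // diagonal_neq_col.
Qed.

(* [V (u - y)^-1] is regular at [u = sigma] once the weight [sigma] has been
   removed from [V]. *)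
Lemma regular_resolvent n (L : seq cell) V : (n < m)%N ->
  (forall c, c \in L -> sigma n.+1 != qcontent q c) -> pea n.+1 V V ->
  V * horner_alg (y n.+1) (\prod_(c <- L) ('X - (qcontent q c)%:P)) = 0 ->
  exists B B', pea n.+1 B B' /\ B * ((u n)%:A - y n.+1) = V.
Proof.
move=> nm; elim: L V => [|c L IHL] V cL pV.
  rewrite big_nil rmorph1 mulr1 => ->; exists 0, 0; split; last exact: mul0r.
  exact: pea_nil.
rewrite big_cons rmorphM /= mulrA => VL.
have [||B [B' [pB BW]]] := IHL _ _ _ VL.
- by move=> c' c'L; apply: cL; rewrite inE c'L orbT.
- rewrite horner_alg_XsubC; apply: peaM => //; apply: peaB; first exact: pea_JM.
  by rewrite -iota_content; apply/pea_alg/pe_emb.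
have uc : u n - qcontent q c != 0 by rewrite subr_eq0 var_generic.
have pu : pe n.+1 (u n) sg (sigma n.+1) by rewrite -iota_content; apply: pe_var_lt.
(* [B] is the resolvent for V (y - c); the formula follows from u - c = (u - y) + (y - c). *)
exists ((u n - qcontent q c)^-1 *: (V + B)), ((sigma n.+1 - qcontent q c)^-1 *: (V + B')).
split.
  apply: peaZ; last exact: peaD.
  apply: peV; first by rewrite subr_eq0 cL ?mem_head.
  by apply: peB => //; rewrite -iota_content; apply: pe_emb.
rewrite -scalerAl mulrDl BW horner_alg_XsubC -mulrDr addrA subrK -scalerBl.
by rewrite -scalerAr mulr1 scalerA mulVf // scale1r.
Qed.

Local Notation f n := (fcoef q t n (size lam) S).

Lemma pea_step n : (n < m)%N ->
  pea n.+1 (idem t n * Phi n (fun j => sigma j))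
    ((S ^+ n * corner_factor q t n (sigma n.+1)) *: idem t n.+1).
Proof.
move=> nm; have nN : (n <= m.-1)%N by lia.
have gn1 : growth t n.+1 := growth_le nm gt; have gn := growth_le (leqnSn n) gn1.
have wt k : (1 <= k <= n.+1)%N -> idem t n.+1 * y k = sigma k *: idem t n.+1.
  by apply: idemP => //; lia.
have pG := pe_corner_factor nm.
have [L qL] : exists L, horner_alg (y n.+1) (qroot_poly q L) = 0.
  by apply: JM_algebraic hT _ => //; lia.
have uq z := var_generic z nm.
pose L' := [seq c <- addables m.-1 t n | c != t n.+1].
have sL c : c \in L' -> sigma n.+1 != qcontent q c.
  rewrite mem_filter => /andP[ct /(mem_addables _ gn nN) aC].
  apply: contraNneq ct => e; apply/eqP; symmetry; apply: (qcontent_addable q0 q_generic _ aC e).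
  exact: (@gt n.+1 nm).
(* The interpolation polynomial takes E to E' and fixes E', whose weight is sigma; so it kills the
   difference, which therefore has only the other contents as weights. *)
have EL : (idem t n - idem t n.+1) *
    horner_alg (y n.+1) (\prod_(c <- L') ('X - (qcontent q c)%:P)) = 0.
  have a0 : \prod_(c <- L') (sigma n.+1 - qcontent q c)^-1 != 0.
    by rewrite prodf_seq_neq0; apply/allP => c /sL; rewrite invr_eq0 subr_eq0.
  apply: (scalerI a0); rewrite scaler0 scalerAr -horner_algZ -scaler_prod big_filter.
  rewrite -/(interp_poly q m.-1 t n.+1) mulrBl -idemS (weight_horner _ (wt n.+1 _)) ?leqnn //.
  by rewrite interp_poly_last // scale1r subrr.
have [|B [B' [pB BV]]] := regular_resolvent nm sL _ EL.
  by apply: peaB; apply: pea_idem => //; apply: ltnW.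
have [ul _ _] := const_unit_longest (ltnW nm); have [ud _ _] := const_unit_down nm.
have fus : idem t n * Phi n (fun j => sigma j) * ((u n)%:A - y n.+1) =
    (S ^+ n * ((u n - sigma n.+1) * corner_factor q t n (u n))) *: idem t n.
  rewrite -(fusion_factorE q0 gn1 uq) -scalerA.
  rewrite -(fusion_resolvent q0 hT nN uq _ _ (mulrV ud) (mulVr ud) (mulrV ul) (mulVr ul)).
  - rewrite scalerAl scalerAr /Phi; congr (_ * _ * _).
    rewrite 2!scalerAl scalerAr; congr (_ * _ * _ * _).
    rewrite -[n in S ^+ n](subn1 n.+1) -prodr_const_nat -scaler_prod.
    apply: eq_big_nat => j jn; rewrite TbE; congr (_ *: (T _ + _)); lia.
  - by move=> k kn; split; [apply: sigma_neq0 | apply: var_generic].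
  - by apply: idemP => //; lia.
pose Z := (S ^+ n * corner_factor q t n (u n)) *: (idem t n.+1 + (u n - sigma n.+1) *: B).
have -> : idem t n * Phi n (fun j => sigma j) = Z.
  apply: (no_weight_eq qL uq); rewrite fus (resolvent_split _ BV (wt n.+1 (leqnn _))).
  by rewrite -mulrA [corner_factor _ _ _ _ * _]mulrC.
have pu : pe n.+1 (u n) sg (sigma n.+1) by rewrite -iota_content; apply: pe_var_lt.
(* The value is given the shape of [Z], so that evaluation can proceed term by term. *)
have -> : idem t n.+1 = idem t n.+1 + (sigma n.+1 - sigma n.+1) *: B'.
  by rewrite subrr scale0r addr0.
apply: peaZ.
  by apply: peM => //; rewrite -rmorphXn; apply: pe_emb.
apply: peaD; first exact: pea_idem.
apply: peaZ => //; apply: peB => //; rewrite -iota_content; apply: pe_emb.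
Qed.

Lemma iota_fcoef n : iota (fcoef (s / r) t n (size lam) s) = f n.
Proof. exact: fmorph_fcoef. Qed.

Lemma pea_Psi n : (n <= m)%N -> pea n (Psi_upto n) ((f n)^-1 *: idem t n).
Proof.
elim: n => [_|n IHn nm].
  have f0 : f 0 = 1.
    rewrite /fcoef big1 => [|i _]; last by rewrite row_length0.
    by rewrite /hook_prod big_geq // !expr0 !invr1 !mulr1.
  by rewrite /Psi_upto big_geq // mul1r invr1 f0 invr1 scale1r; apply: pea1.
have gn1 : growth t n.+1 := growth_le nm gt.
have bound : ((t n.+1).1 <= size lam)%N by apply: (std_row_bound std); lia.
(* The first n evaluations turn everything before the last block into a multiple of [idem t n],
   whose weights [pea_step] needs to handle that block. *)
rewrite Psi_uptoS //; apply: pea_trans (peaM (IHn (ltnW nm)) (pea_Phi nm)) _.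
have fn : (f n)^-1 = (f n.+1)^-1 / (S ^+ n * corner_factor q t n (sigma n.+1)).
  by rewrite (fcoefS q0 q_generic S0 gn1 bound) invfM.
have fn0 := fcoef_neq0 q0 q_generic (size lam) S0 (growth_le (leqnSn n) gn1).
have G0 : S ^+ n * corner_factor q t n (sigma n.+1) != 0.
  by apply: contraNneq fn0; rewrite (fcoefS q0 q_generic S0 gn1 bound) => ->; rewrite mulr0.
have -> : (f n.+1)^-1 = (f n)^-1 * (S ^+ n * corner_factor q t n (sigma n.+1)).
  by rewrite fn divfK.
rewrite -scalerAl -scalerA; apply: peaZ; last exact: pea_step.
by rewrite -iota_fcoef -fmorphV; apply: pe_emb.
Qed.

End FusionProcedure.

Theorem theorem6p1 (r s : CC) (m : nat) (lam : seq nat) (t : nat -> cell)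
  (A : unitAlgType (RF m)) (T : nat -> A) :
  r != 0 -> s != 0 ->
  (forall n : nat, (0 < n)%N -> (r / s) ^+ n != 1) ->
  (1 <= m)%N ->
  is_partition m lam ->
  standard_tableau m lam t ->
  hecke_rels T r s ->
  exists Y : A,
    eval_alg T (Psi T r s) (fun k => content r s (t k.+1)) Y /\
    Eidem T r s t m = emb m (fnorm r s m lam) *: Y.
Proof.
move=> r0 s0 ru m0 part std hT.
have pP := pea_Psi r0 s0 ru m0 part std hT (leqnn m).
eexists; split.
  have PsiE : Psi T r s = Psi_upto r s T m.
    rewrite /Psi /Psi_upto TwE; congr (_ * _).
  by rewrite PsiE; apply: pea_eval_alg pP.
rewrite (EidemE T r0 s0 m0 part std) // (fnormE part std) -iota_fcoef scalerA.
rewrite mulfV ?scale1r // fmorph_eq0; apply: fcoef_neq0 => //.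
- by rewrite mulf_neq0 ?invr_eq0.
- by move=> z; apply: generic_C.
exact: std_growth part std.
Qed.
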